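(* Let $G$ and $H$ be undirected simple graphs on $N=\{1,\dots,n\}$. (a) $\dim(\mathcal M(G,H))\le |E_G\cap E_H|+n$. (b) If $G\cup H=K_N$ is the complete graph on $N$, then $\mathcal M(G,H)$ is smooth of dimension $|E_G\cap E_H|+n$. (c) Conversely, if $\mathcal M(G,H)$ attains this maximal dimension $|E_G\cap E_H|+n$, then its top-dimensional connected components (the connected components, in the Euclidean topology, of dimension $|E_G\cap E_H|+n$) are smooth with irreducible Zariski closure.
   Context: $E_G$ denotes the edge set of $G$; $G\cup H$ is the graph on $N$ with edge set $E_G\cup E_H$. $\mathrm{PD}_n$ is the set of real symmetric positive definite $n\times n$ matrices, inside the real vector space $\mathrm{Sym}^2(\mathbb R^n)\cong\mathbb R^{\binom{n+1}{2}}$ of symmetric matrices. $$\mathcal M(G,H)=\{\Sigma\in\mathrm{PD}_n : (\Sigma^{-1})_{ij}=0 \text{ for all } i\ne j,\ ij\notin E_G;\ \Sigma_{kl}=0\text{ for all } k\neq l,\ kl\notin E_H\}.$$ For a semi-algebraic set $\Theta\subseteq\mathbb R^m$, $\mathcal I(\Theta)\subseteq\mathbb R[x_1,\dots,x_m]$ is the ideal of real polynomials vanishing on $\Theta$, the Zariski closure $\overline\Theta$ is the real zero set of $\mathcal I(\Theta)$, and $\dim\Theta$ is the Krull dimension of $\mathbb R[x_1,\dots,x_m]/\mathcal I(\Theta)$. For a real algebraic set $V$ with $\mathcal I(V)=\langle f_1,\dots,f_r\rangle$, the Zariski tangent space $T_pV$ is the kernel of the Jacobian matrix $(\partial f_i/\partial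 x_j(p))$. An irreducible real algebraic set $V$ is smooth at $p\in V$ if $\dim T_pV=\dim V$. A semi-algebraic set $\Theta$ is smooth at $p\in\Theta$ if $p$ lies in a unique irreducible component $Z$ of $\overline\Theta$ and $Z$ is smooth at $p$; $\Theta$ is smooth if it is smooth at each of its points. *)

(* Defs.v *)
From HB Require Import structures.
From mathcomp Require Import all_boot all_order all_algebra.
From mathcomp Require Import all_classical all_reals all_analysis.
From mathcomp Require mpoly.
(* The notations of mpoly clash with those of mathcomp-analysis. *)
Import (canonicals) mpoly.

Set Implicit Arguments.
Unset Strict Implicit.
Unset Printing Implicit Defensive.

Import Order.TTheory GRing.Theory Num.Theory.
Import numFieldNormedType.Exports.

Local Open Scope classical_set_scope.
Local Open Scope ring_scope.

(* A simple graph on the vertex set 'I_n is its set of 2-element edges. *)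
Record sgraph (n : nat) := SGraph {
  edges : {set {set 'I_n}};
  edges_card2 : [forall e in edges, #|e| == 2%N] }.

Section Graphs.
Variable n : nat.
Implicit Types G H : sgraph n.

Definition adj G (i j : 'I_n) : bool := [set i; j]%SET \in edges G.

Lemma graph_union_subproof G H :
  [forall e in edges G :|: edges H, #|e| == 2%N].
Proof.
apply/forall_inP => e; rewrite inE => /orP[] he.
  exact: (forall_inP (edges_card2 G)).
exact: (forall_inP (edges_card2 H)).
Qed.

Definition graph_union G H : sgraph n := SGraph (graph_union_subproof G H).

Lemma complete_graph_subproof :
  [forall e in [set e : {set 'I_n} | #|e| == 2%N]%SET, #|e| == 2%N].
Proof. by apply/forall_inP => e; rewrite inE. Qed.

Definition complete_graph : sgraph n := SGraph complete_graph_subproof.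

End Graphs.

Definition has_prime_chain (A : comNzRingType) (k : nat) : Prop :=
  exists P : 'I_k.+1 -> prime_idealr A,
    forall i j : 'I_k.+1, (i < j)%N ->
      {subset P i <= P j} /\ ~ {subset P j <= P i}.

(* Valued in the extended reals because the supremum may be infinite. *)
Definition krull_dim (R : realType) (A : comNzRingType) : \bar R :=
  ereal_sup [set k%:R%:E | k in has_prime_chain A].

Section RealAlgebraicGeometry.
Variables (R : realType) (m : nat).
Local Notation point := 'rV[R]_m.
Local Notation poly_m := (mpoly.mpoly m R).
Implicit Types (X V W Z : set point) (S : set poly_m) (p : point).

Definition peval (f : poly_m) p : R := mpoly.meval (p 0) f.

Definition vanishing_ideal X : set poly_m :=
  [set f | forall p, X p -> peval f p = 0].

Definition zero_locus S : set point :=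
  [set p | forall f, S f -> peval f p = 0].

Definition zariski_closure X : set point := zero_locus (vanishing_ideal X).

(* [vanishing_ideal X] as a boolean predicate; the ideals of the library are
   proper, whence the nonemptiness argument. *)
Definition vanishing_pred X (X0 : X !=set0) : {pred poly_m} :=
  fun f => `[< vanishing_ideal X f >].

Lemma vanishing_pred_idealr X (X0 : X !=set0) :
  idealr_closed (vanishing_pred X0).
Proof.
split.
- by apply/asboolP => p _; rewrite /peval mpoly.meval0.
- apply/asboolPn => h; case: X0 => p /h /eqP.
  by rewrite /peval mpoly.meval1 oner_eq0.
- move=> a u v /asboolP hu /asboolP hv; apply/asboolP => p Xp.
  by rewrite /peval mpoly.mevalD mpoly.mevalM -!/(peval _ _) hu// hv// mulr0 addr0.
Qed.

HB.instance Definition _ X (X0 : X !=set0) :=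
  isIdealr.Build poly_m (vanishing_pred X0) (vanishing_pred_idealr X0).

(* For empty X the quotient is the zero ring, which is not a [comNzRingType]
   and has no prime ideals: its dimension is the supremum of the empty set. *)
Definition dimension X : \bar R :=
  match pselect (X !=set0) with
  | left X0 => krull_dim R {ideal_quot (vanishing_pred X0)}
  | right _ => -oo%E
  end.

Definition algebraic V : Prop := exists S, V = zero_locus S.

Definition irreducible V : Prop :=
  [/\ algebraic V, V !=set0 &
      forall V1 V2, algebraic V1 -> algebraic V2 ->
        V = V1 `|` V2 -> V = V1 \/ V = V2].

Definition irreducible_component V Z : Prop :=
  [/\ irreducible Z, Z `<=` V &
      forall W, irreducible W -> Z `<=` W -> W `<=` V -> W = Z].

Definition generated_ideal r (f : 'I_r -> poly_m) : set poly_m :=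
  [set g | exists h : 'I_r -> poly_m, g = \sum_(i < r) h i * f i].

Definition poly_jacobian r (f : 'I_r -> poly_m) p : 'M[R]_(r, m) :=
  \matrix_(i < r, j < m) peval (mpoly.mderiv j (f i)) p.

(* The row space of [tangent_space f p] is the space of all row vectors v with
   poly_jacobian f p *m v^T = 0. *)
Definition tangent_space r (f : 'I_r -> poly_m) p : 'M[R]_m :=
  kermx (poly_jacobian f p)^T.

(* The dimension of the tangent space does not depend on the chosen finite
   system of generators, and one exists by Hilbert's basis theorem. *)
Definition algebraic_smooth_at V p : Prop :=
  exists r (f : 'I_r -> poly_m),
    vanishing_ideal V = generated_ideal f /\
    (\rank (tangent_space f p))%:R%:E = dimension V.

Definition smooth_at X p : Prop :=
  exists2 Z,
    unique (fun Z' => irreducible_component (zariski_closure X) Z' /\ Z' p) Z &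
    algebraic_smooth_at Z p.

Definition smooth X : Prop := forall p, X p -> smooth_at X p.

Definition is_connected_component X (C : set point) : Prop :=
  exists2 p, X p & C = connected_component X p.

End RealAlgebraicGeometry.

Section SymmetricMatrices.
Variables (R : realType) (n : nat).

Definition posdef (S : 'M[R]_n) : Prop :=
  S^T = S /\ forall v : 'rV[R]_n, v != 0 -> 0 < (v *m S *m v^T) 0 0.

(* Sym^2(R^n) is identified with R^(sym_dim n) through the entries on and above
   the diagonal. *)
Definition sym_index : finType := {p : 'I_n * 'I_n | (p.1 <= p.2)%N}.

Definition sym_dim : nat := #|sym_index|.

Lemma sym_dimE : sym_dim = 'C(n.+1, 2).
Proof.
rewrite /sym_dim card_sig -sum1_card.
rewrite (eq_bigl (fun p : 'I_n * 'I_n => true && (p.1 <= p.2)%N)) //.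
rewrite -(pair_big_dep xpredT (fun i j : 'I_n => (i <= j)%N) (fun _ _ => 1%N)) /=.
rewrite (exchange_big_dep xpredT) //= -bin2_sum big_mkord big_ord_recl /= add0n.
apply: eq_bigr => j _; rewrite /bump /= add1n.
rewrite -(big_ord_widen n (fun=> 1%N) (ltn_ord j)).
by rewrite sum1_card card_ord.
Qed.

Definition sym_coord (S : 'M[R]_n) : 'rV[R]_sym_dim :=
  \row_(k < sym_dim) let ij := val (enum_val k) in S ij.1 ij.2.

End SymmetricMatrices.

Section DoubleMarkovian.
Variables (R : realType) (n : nat).

Definition double_markovian (G H : sgraph n) : set 'M[R]_n :=
  [set S | [/\ posdef S,
    forall i j, i != j -> ~~ adj G i j -> invmx S i j = 0 &
    forall k l, k != l -> ~~ adj H k l -> S k l = 0]].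

Definition dm_model (G H : sgraph n) : set 'rV[R]_(sym_dim n) :=
  @sym_coord R n @` double_markovian G H.

End DoubleMarkovian.

Arguments double_markovian R {n} G H.
Arguments dm_model R {n} G H.

(* Main.v *)
(* Adding to G the non-edges of H does not change the common edges and enlarges the
   model, so let X be the model of two graphs covering the complete graph.  The
   entries of Sigma at the diagonal and at the common edges then parametrize X by an
   open convex set: the remaining entries are those of the completion of maximal
   determinant (Dempster), which is unique because tr(K U K' U) > 0 for K, K'
   positive definite and U <> 0 symmetric.  The same inequality makes the defining
   equations transversal along X, which gives the tangent spaces.

   - The ideal of X is prime: if f vanishes on an open part of X then it vanishes on
     the lift to X of every segment of parameters, because the iterated derivatives of
     f along the lift satisfy a linear system of differential equations (Hilbert's
     basis theorem) with zero initial values.  Fixing the parameters one after the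
     other gives a chain of primes of length d, the number of parameters.
   - Any d + 1 polynomials a are algebraically dependent on X: perturb the equations
     adj(Sigma)_ij = 0 to 2 adj(Sigma)_ij = eps c Sigma_ij^D with D large, so that
     monomials can be reduced to exponents < D in the completed entries; counting
     gives a relation Q_eps(a) = 0 of bounded degree on the perturbed system, whose
     solutions approach X, and a normalized limit of Q_eps is the wanted relation.
     Hence chains of primes over the ideal of X have length at most d.
   - A subset of X of dimension d has the ideal of X, since otherwise the prime ideal
     of X would extend one of its chains; this is the converse statement. *)

From HB Require Import structures.
Require Import Defs.
From mathcomp Require Import all_boot all_order all_algebra.
From mathcomp Require Import all_classical all_reals all_analysis.
From mathcomp Require Import ring lra.
From mathcomp Require mpoly.
Import (canonicals, coercions) mpoly.

Set Implicit Arguments.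
Unset Strict Implicit.
Unset Printing Implicit Defensive.

Import Order.TTheory GRing.Theory Num.Theory.
Import numFieldNormedType.Exports.

Local Open Scope classical_set_scope.
Local Open Scope ring_scope.

(** * Hilbert's basis theorem *)

(** After each chosen index, take one at which the remaining tail of [u] is minimal; minima of
    shrinking tails can only grow. *)
Lemma nondecreasing_subseq (u : nat -> nat) : exists phi : nat -> nat,
  {homo phi : i j / (i < j)%N} /\ {homo u \o phi : i j / (i <= j)%N}.
Proof.
have /choice[f fP] : forall N, exists i, (N <= i)%N /\
    forall j, (N <= j)%N -> (u i <= u j)%N.
  move=> N.
  have ex : exists v, `[< exists2 i, (N <= i)%N & u i = v >].
    by exists (u N); apply/asboolP; exists N.
  case: (ex_minnP ex) => v /asboolP[i Ni uiv] vmin.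
  by exists i; split => // j Nj; rewrite uiv vmin //; apply/asboolP; exists j.
pose phi := fix phi k := if k is k'.+1 then f (phi k').+1 else f 0%N.
have phiS k : (phi k < phi k.+1)%N by case: (fP (phi k).+1).
exists phi; split; first exact: (homo_ltn ltn_trans).
apply: (homo_leq leqnn leq_trans) => k /=.
have [N eqN] : exists N, phi k = f N by case: k => [|k]; [exists 0%N | exists (phi k).+1].
case: (fP N); rewrite -eqN => Nk; apply.
exact: leq_trans (ltnW (phiS k)).
Qed.

(** Refining the subsequence for one coordinate after another makes every exponent nondecreasing, so
    already its first two terms are comparable. *)
Lemma dickson n (u : nat -> mpoly.multinom n) :
  exists i j, (i < j)%N /\ mpoly.lem (u i) (u j).
Proof.
suff [phi [phi1 phi2]] : exists phi : nat -> nat, {homo phi : i j / (i < j)%N} /\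
    forall l, l \in enum 'I_n -> {homo (fun k => u (phi k) l) : i j / (i <= j)%N}.
  exists (phi 0%N), (phi 1%N); split; first exact: phi1.
  by apply/mpoly.mnm_lepP => l; apply: phi2; rewrite ?mem_enum.
elim: (enum 'I_n) => [|l s [phi [phi1 phi2]]]; first by exists id; split.
have [psi [psi1 psi2]] := nondecreasing_subseq (fun k => u (phi k) l).
exists (phi \o psi); split; first by move=> i j /psi1/phi1.
move=> l'; rewrite inE => /predU1P[-> i j /psi2 //|/phi2 h i j].
move=> ij; apply: h.
exact: (homo_leq leqnn leq_trans (fun k => ltnW (psi1 _ _ (ltnSn k)))) ij.
Qed.

Section HilbertBasis.
Variables (R : realType) (m : nat).
Local Notation poly_m := (mpoly.mpoly m R).
Implicit Types (f g h : poly_m) (I : set poly_m).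

Definition ideal_set I : Prop :=
  [/\ I 0, forall f g, I f -> I g -> I (f + g) & forall h f, I f -> I (h * f)].

(** Recursion on the generators opens membership to induction; [ideal_spanE] links it to
    [generated_ideal]. *)
Fixpoint ideal_span (s : seq poly_m) : set poly_m :=
  if s is f :: s' then [set g | exists h, ideal_span s' (g - h * f)] else [set 0].

Lemma ideal_span_ideal s : ideal_set (ideal_span s).
Proof.
elim: s => [|a s [s0 sD sM]] /=.
  by split => [//|f g -> ->|h f ->]; rewrite ?addr0 ?mulr0.
split => [|f g [h1 hf] [h2 hg]|h f [h1 hf]].
- by exists 0; rewrite mul0r subr0.
- exists (h1 + h2); have -> : f + g - (h1 + h2) * a = (f - h1 * a) + (g - h2 * a) by ring.
  exact: sD.
- exists (h * h1); have -> : h * f - h * h1 * a = h * (f - h1 * a) by ring.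
  exact: sM.
Qed.

Lemma ideal_span_sub I s : ideal_set I -> {in s, forall f, I f} ->
  ideal_span s `<=` I.
Proof.
move=> [I0 ID IM]; elim: s => [|a s IH] sI /=; first by move=> _ ->.
move=> g [h gs]; rewrite -(subrK (h * a) g); apply: ID.
  by apply: IH gs => f fs; apply: sI; rewrite inE fs orbT.
by apply/IM/sI; rewrite mem_head.
Qed.

Lemma mem_ideal_span s f : f \in s -> ideal_span s f.
Proof.
elim: s => [//|a s IH] /=; rewrite inE => /predU1P[->|/IH fs].
  by exists 1; rewrite mul1r subrr; have [] := ideal_span_ideal s.
by exists 0; rewrite mul0r subr0.
Qed.

Lemma ideal_spanE s :
  ideal_span s = generated_ideal (fun i : 'I_(size s) => s`_i).
Proof.
apply/seteqP; split => [g|g [h ->]]; last first.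
  have [s0 sD sM] := ideal_span_ideal s.
  apply: big_ind => // i _; apply: sM.
  exact/mem_ideal_span/mem_nth.
elim: s g => [|a s IH] g /=.
  by move=> ->; exists (fun=> 0); rewrite big_ord0.
move=> [h /IH[k gk]].
exists (fun i => if unlift ord0 i is Some j then k j else h).
rewrite big_ord_recl unlift_none /= -[LHS](subrK (h * a)) gk addrC; congr (_ + _).
by apply: eq_bigr => i _; rewrite liftK.
Qed.

(** One division step: the quotient of the leading terms, times [f], cancels the leading term of
    [g]. *)
Lemma lead_reduction f g : f != 0 -> mpoly.lem (mpoly.mlead f) (mpoly.mlead g) ->
  exists h, g - h * f = 0 \/ (mpoly.mlead (g - h * f) < mpoly.mlead g)%O.
Proof.
move=> f0 fg; set a := mpoly.mlead f; set b := mpoly.mlead g in fg *.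
have lf0 : mpoly.mcoeff a f != 0 by rewrite mpoly.mleadc_eq0.
pose c := mpoly.mcoeff b g / mpoly.mcoeff a f.
pose h := c *: mpoly.mpolyX R (mpoly.mnm_sub b a).
exists h; have [->|r0] := eqVneq (g - h * f) 0; [by left | right].
rewrite lt_neqAle; apply/andP; split.
  apply/eqP => e; move: r0; rewrite -mpoly.mleadc_eq0 e => /eqP; apply.
  have := mpoly.mcoeffMX f (mpoly.mnm_sub b a) a; rewrite (mpoly.submK fg) => fX.
  rewrite mpoly.mcoeffB /h -scalerAl mpoly.mcoeffZ [mpoly.mpolyX _ _ * f]mulrC fX.
  by rewrite /c divfK// subrr.
apply: (le_trans (mpoly.mleadB_le _ _)); rewrite leUx lexx /=.
apply: (le_trans (mpoly.mleadM_le _ _)).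
rewrite -[leRHS](mpoly.submK fg) mpoly.lemc_add2l.
by apply: (le_trans (mpoly.mleadZ_le _ _)); rewrite mpoly.mleadXm.
Qed.

(** Otherwise pick successively elements of [I] outside the span of the earlier ones, with minimal
    leading monomial. By Dickson's lemma an earlier leading monomial divides a later one, and a
    division step produces a smaller candidate. *)
Theorem hilbert_basis I : ideal_set I ->
  exists s, {in s, forall f, I f} /\ I = ideal_span s.
Proof.
move=> idI; apply: contrapT => /forallNP noB; have [I0 ID IM] := idI.
have /choice[nx nxP] : forall s, exists f, {in s, forall f, I f} ->
    [/\ I f, ~ ideal_span s f & forall g, I g -> ~ ideal_span s g ->
        ~ (mpoly.mlead g < mpoly.mlead f)%O].
  move=> s; have [sI|] := pselect {in s, forall f, I f}; last by exists 0.
  have [f [If fs]] : exists f, I f /\ ~ ideal_span s f.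
    apply: contrapT => /forallNP nf; apply: (noB s); split => //.
    apply/seteqP; split; last exact: ideal_span_sub.
    by move=> f If; apply: contrapT => fs; apply: (nf f).
  (* Descend along the well-founded monomial order to a minimal choice. *)
  have [k kE] : exists k, k = mpoly.mlead f by exists (mpoly.mlead f).
  elim/(well_founded_ind (@mpoly.ltom_wf m)): k f kE If fs => k IH f kE If fs.
  have [[g [Ig gs gf]]|nog] := pselect (exists g, [/\ I g, ~ ideal_span s g
      & (mpoly.mlead g < mpoly.mlead f)%O]).
    by apply: (IH (mpoly.mlead g)) Ig gs; rewrite ?kE.
  exists f => _; split => // g Ig gs gf; apply: nog; by exists g.
pose S k := iter k (fun s => nx s :: s) [::].
have SI k : {in S k, forall f, I f}.
  elim: k => [//|k IH] f /=; rewrite inE => /predU1P[->|/IH//].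
  by have [] := nxP _ IH.
have Ssub i j : (i < j)%N -> nx (S i) \in S j.
  elim: j => [//|j IH]; rewrite ltnS leq_eqVlt => /predU1P[->|/IH h] /=.
    by rewrite mem_head.
  by rewrite inE h orbT.
have [i [j [ij le_ij]]] := dickson (fun k => mpoly.mlead (nx (S k))).
have [Ij js jmin] := nxP _ (SI j); have [s0 sD sM] := ideal_span_ideal (S j).
have [Ii is_ _] := nxP _ (SI i).
have i0 : nx (S i) != 0.
  by apply: contra_not_neq is_ => ->; have [] := ideal_span_ideal (S i).
have [h hP] := lead_reduction i0 le_ij.
have hs : ideal_span (S j) (h * nx (S i)) by apply/sM/mem_ideal_span/Ssub.
case: hP => [e|].
  by apply: js; rewrite -(subrK (h * nx (S i)) (nx (S j))) e add0r.
apply: jmin; first by apply: (ID) => //; rewrite -mulNr; apply: IM.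
by move=> r; apply: js; rewrite -(subrK (h * nx (S i)) (nx (S j))); apply: sD.
Qed.

(** The union of the ideals of the initial segments is finitely generated, and its generators
    already lie in a single stage. *)
Lemma ideal_chain_stabilizes (g : nat -> poly_m) :
  exists r, ideal_span (mkseq g r) (g r).
Proof.
pose I : set poly_m := [set f | exists r, ideal_span (mkseq g r) f].
have mono r s : (r <= s)%N -> ideal_span (mkseq g r) `<=` ideal_span (mkseq g s).
  move=> rs; apply: ideal_span_sub; first exact: ideal_span_ideal.
  move=> f /mapP[i]; rewrite mem_iota /= add0n => ir ->.
  apply: mem_ideal_span; apply: map_f.
  by rewrite mem_iota /= add0n (leq_trans ir).
have idI : ideal_set I.
  split; first by exists 0%N.
    move=> f1 f2 [r1 h1] [r2 h2]; exists (maxn r1 r2).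
    have [_ + _] := ideal_span_ideal (mkseq g (maxn r1 r2)); apply.
      by apply: mono h1; rewrite leq_maxl.
    by apply: mono h2; rewrite leq_maxr.
  move=> h f [r fr]; exists r; have [_ _] := ideal_span_ideal (mkseq g r); exact.
have [s [sI Is]] := hilbert_basis idI.
have [r sr] : exists r, {in s, forall f, ideal_span (mkseq g r) f}.
  elim: s sI {Is} => [|f s IH] sI; first by exists 0%N.
  have [r1 h1] : I f by apply: sI; rewrite mem_head.
  have [r2 h2] := IH (fun e es => sI e (mem_behead (s := f :: s) es)).
  exists (maxn r1 r2) => f'; rewrite inE => /predU1P[->|/h2].
    by apply: mono h1; rewrite leq_maxl.
  by apply: mono; rewrite leq_maxr.
exists r; have : I (g r).
  exists r.+1; apply: mem_ideal_span; apply: map_f.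
  by rewrite mem_iota /= add0n.
rewrite Is; apply: ideal_span_sub => //; exact: ideal_span_ideal.
Qed.

End HilbertBasis.

(** * Prime chains and dimension *)

Section PrimeChains.
Variables (R : realType) (m : nat).
Local Notation poly_m := (mpoly.mpoly m R).
Local Notation point := 'rV[R]_m.
Implicit Types (f g h : poly_m) (I J P : set poly_m) (X : set point).

Definition prime_set P : Prop :=
  [/\ ideal_set P, ~ P 1 & forall f g, P (f * g) -> P f \/ P g].

(** Chains of primes of the quotient by [I], pulled back to the polynomial ring. *)
Definition prime_chain I (k : nat) : Prop :=
  exists P : nat -> set poly_m,
    [/\ forall i, (i <= k)%N -> prime_set (P i), I `<=` P 0%N &
        forall i, (i < k)%N -> P i `<=` P i.+1 /\ ~ P i.+1 `<=` P i].

Lemma peval0 (p : point) : peval 0 p = 0.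
Proof. exact: mpoly.meval0. Qed.

Lemma peval1 (p : point) : peval 1 p = 1.
Proof. exact: mpoly.meval1. Qed.

Lemma pevalD f g (p : point) : peval (f + g) p = peval f p + peval g p.
Proof. exact: mpoly.mevalD. Qed.

Lemma pevalB f g (p : point) : peval (f - g) p = peval f p - peval g p.
Proof. exact: mpoly.mevalB. Qed.

Lemma pevalM f g (p : point) : peval (f * g) p = peval f p * peval g p.
Proof. exact: mpoly.mevalM. Qed.

Lemma vanishing_ideal_set X : ideal_set (vanishing_ideal X).
Proof.
split => [p _|f g hf hg p Xp|h f hf p Xp]; first exact: peval0.
  by rewrite pevalD hf// hg// addr0.
by rewrite pevalM hf// mulr0.
Qed.

Lemma vanishing_idealS X Y : X `<=` Y -> vanishing_ideal Y `<=` vanishing_ideal X.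
Proof. by move=> XY f hf p /XY; exact: hf. Qed.

Section Quotient.
Variables (X : set point) (X0 : X !=set0).
Local Notation I := (vanishing_ideal X).
Local Notation quot := {ideal_quot (vanishing_pred X0)}.
Local Notation qpi := (\pi_(quot)%qT).

Lemma quot_piP f g : (f == g %[mod quot])%qT <-> I (f - g).
Proof. by rewrite -Quotient.idealrBE; split => /asboolP. Qed.

Lemma qpi0 : qpi 0 = 0 :> quot.
Proof. exact: (raddf0 \pi_(quot)%qT). Qed.

Lemma qpi1 : qpi 1 = 1 :> quot.
Proof. exact: (rmorph1 \pi_(quot)%qT). Qed.

Lemma qpiD f g : qpi (f + g) = qpi f + qpi g :> quot.
Proof. exact: (raddfD \pi_(quot)%qT). Qed.

Lemma qpiM f g : qpi (f * g) = qpi f * qpi g :> quot.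
Proof. exact: (rmorphM \pi_(quot)%qT). Qed.

Section Lift.
Variables (P : set poly_m) (primeP : prime_set P) (IP : I `<=` P).

(** The image of [P] in the quotient, tested on a representative; as [P] contains the ideal, the
    choice does not matter. *)
Definition quot_pred : {pred quot} := fun q => `[< P (repr q) >].

Lemma quot_predP f : reflect (P f) (qpi f \in quot_pred).
Proof.
have [[P0 PD PM] _ _] := primeP.
have hI : I (repr (qpi f) - f) by apply/quot_piP; rewrite reprK.
have PB g h : P (g - h) -> P h -> P g by move=> ? ?; rewrite -(subrK h g); exact: PD.
rewrite -[_ \in _]/(`[< P (repr (qpi f)) >]).
apply: (iffP (asboolP _)) => [|Pf]; last by apply: (PB _ f) => //; exact: IP.
move=> h; apply: (PB _ (repr (qpi f))) => //.
by rewrite -opprB -mulN1r; apply/PM/IP.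
Qed.

Lemma quot_pred_idealr : idealr_closed quot_pred.
Proof.
have [[P0 PD PM] P1 _] := primeP; split.
- by rewrite -qpi0; apply/quot_predP.
- by rewrite -qpi1; apply/quot_predP.
- move=> a u v; rewrite -[a]reprK -[u]reprK -[v]reprK.
  move=> /quot_predP hu /quot_predP hv; rewrite -qpiM -qpiD.
  by apply/quot_predP; apply/PD => //; exact: PM.
Qed.

Lemma quot_pred_prime : prime_idealr_closed quot_pred.
Proof.
have [_ _ Pp] := primeP => u v; rewrite -[u]reprK -[v]reprK -qpiM.
move=> /quot_predP/Pp[] h; apply/orP; [left|right]; exact/quot_predP.
Qed.

HB.instance Definition _ := isIdealr.Build quot quot_pred quot_pred_idealr.
HB.instance Definition _ := isPrimeIdealrClosed.Build quot quot_pred quot_pred_prime.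

Definition quot_prime_idealr : prime_idealr quot := quot_pred.

End Lift.

(** Primes of the quotient have preimages under the projection; conversely, primes containing the
    ideal have prime images. *)
Lemma has_prime_chain_quot k : has_prime_chain quot k <-> prime_chain I k.
Proof.
split => [[Q QP]|[P [primeP IP PS]]].
  exists (fun i => [set f | qpi f \in Q (inord i)]); split.
  - move=> i _; split; first split => [|f g /= fQ gQ|h f /= fQ].
    + by rewrite /= qpi0 rpred0.
    + by rewrite qpiD rpredD.
    + by rewrite qpiM idealMr.
    + by rewrite /= qpi1 idealr1.
    + by move=> f g /=; rewrite qpiM prime_idealrM => /orP.
  - move=> f fI /=; rewrite [qpi f](_ : _ = 0) ?rpred0 //.
    by rewrite -qpi0; apply/eqP/quot_piP; rewrite subr0.
  - move=> i ik; have [|QS nQS] := QP (inord i) (inord i.+1).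
      by rewrite !inordK ?ltnS // ltnW.
    split => [f|h]; first exact: QS.
    by apply: nQS => q; rewrite -[q]reprK; exact: h.
have mono i j : (i <= j)%N -> (j <= k)%N -> P i `<=` P j.
  elim: j => [|j IH]; first by rewrite leqn0 => /eqP -> _ f.
  rewrite leq_eqVlt => /predU1P[-> _ f //|ij jk].
  by apply: (subset_trans (IH ij (ltnW jk))); case: (PS _ jk).
have IPi (i : 'I_k.+1) : I `<=` P i by apply: (subset_trans IP); apply: mono => //; case: i.
have lek (i : 'I_k.+1) : (i <= k)%N by case: i.
exists (fun i => quot_prime_idealr (primeP _ (lek i)) (@IPi i)).
move=> i j ij; split.
  move=> q; rewrite -[q]reprK => /(quot_predP (primeP _ (lek i)) (@IPi i)) h.
  by apply/(quot_predP (primeP _ (lek j)) (@IPi j)); apply: mono h => //; exact: ltnW.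
move=> h; have ik : (i < k)%N by rewrite (leq_trans ij).
case: (PS _ ik) => _; apply => f fP.
apply/(quot_predP (primeP _ (lek i)) (@IPi i)); apply: h.
by apply/(quot_predP (primeP _ (lek j)) (@IPi j)); exact: mono fP.
Qed.

End Quotient.

Lemma dimension_le X d : (forall k, prime_chain (vanishing_ideal X) k -> (k <= d)%N) ->
  (dimension X <= d%:R%:E)%E.
Proof.
rewrite /dimension; case: pselect => [X0|_ _]; last exact: leNye.
move=> h; apply: ge_ereal_sup => _ [k /= hk <-].
by rewrite lee_fin ler_nat; apply: h; apply/has_prime_chain_quot.
Qed.

Lemma dimension_ge X k : X !=set0 -> prime_chain (vanishing_ideal X) k ->
  (k%:R%:E <= dimension X)%E.
Proof.
rewrite /dimension; case: pselect => // X0 _ h; apply: ereal_sup_ubound.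
by exists k => //; apply/has_prime_chain_quot.
Qed.

(** If all chains were shorter than [d], the supremum would be at most [d - 1], or [-oo] when
    [d = 0]. *)
Lemma dimension_chain X d : dimension X = d%:R%:E ->
  X !=set0 /\ exists2 k, (d <= k)%N & prime_chain (vanishing_ideal X) k.
Proof.
move=> dX; have [X0 /= | nX0] := pselect (X !=set0); last first.
  by move: dX; rewrite /dimension; case: pselect.
split => //; apply: contrapT => nch.
have lt k : prime_chain (vanishing_ideal X) k -> (k < d)%N.
  by move=> hk; rewrite ltnNge; apply/negP => dk; apply: nch; exists k.
case: d dX lt nch => [|d] dX lt nch.
  have : (dimension X <= -oo)%E.
    rewrite /dimension; case: pselect => // X0'; apply: ge_ereal_sup => y [k /= hk _].
    by have /lt := (has_prime_chain_quot X0' k).1 hk.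
  by rewrite dX.
have : (dimension X <= d%:R%:E)%E by apply: dimension_le => k /lt.
by rewrite dX lee_fin ler_nat ltnn.
Qed.

Lemma prime_chainS I J k : I `<=` J -> prime_chain J k -> prime_chain I k.
Proof. by move=> IJ [P [P1 P2 P3]]; exists P; split => //; exact: subset_trans P2. Qed.

(** The new chain starts with [I] itself. A bound on the chains over a prime ideal thus forces
    equality with any larger ideal that has a chain of maximal length. *)
Lemma prime_chain_extend I J k : prime_set I -> I `<=` J -> I <> J ->
  prime_chain J k -> prime_chain I k.+1.
Proof.
move=> pI IJ nIJ [P [P1 P2 P3]].
exists (fun i => if i is i'.+1 then P i' else I); split => //.
  by case=> // i; rewrite ltnS; exact: P1.
case=> [_|i]; last exact: P3.
split; first exact: subset_trans P2.
move=> PI; apply: nIJ; apply/seteqP; split => //.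
exact: subset_trans PI.
Qed.

Lemma dimension_vanishing X Y : vanishing_ideal X = vanishing_ideal Y ->
  X !=set0 -> Y !=set0 -> dimension X = dimension Y.
Proof.
move=> XY X0 Y0; rewrite /dimension; case: pselect => // X1; case: pselect => // Y1.
rewrite /krull_dim; congr (ereal_sup (_ @` _)); apply/funext => k; apply/propext.
by rewrite (propext (has_prime_chain_quot _ _)) (propext (has_prime_chain_quot _ _)) XY.
Qed.

Lemma vanishing_zariski_closure X :
  vanishing_ideal (zariski_closure X) = vanishing_ideal X.
Proof.
apply/seteqP; split => f hf p; first by move=> Xp; apply: hf => g; exact.
exact.
Qed.

Lemma sub_zariski_closure X : X `<=` zariski_closure X.
Proof. by move=> p Xp f; exact. Qed.

(** If the closure were a union of two smaller zero loci, each would have a defining polynomial that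
    does not vanish on [X], while their product does. *)
Lemma irreducible_closure X : X !=set0 -> prime_set (vanishing_ideal X) ->
  irreducible (zariski_closure X).
Proof.
move=> [p0 Xp0] [_ _ pX]; split.
- by exists (vanishing_ideal X).
- by exists p0; exact: sub_zariski_closure.
- move=> _ _ [S1 ->] [S2 ->] eV; apply: contrapT => /not_orP[n1 n2].
  have wit S : zero_locus S `<=` zariski_closure X ->
      zariski_closure X <> zero_locus S -> exists2 f, S f & ~ vanishing_ideal X f.
    move=> SX nS; apply: contrapT => nf; apply: nS; apply/seteqP; split => // p pX' f Sf.
    by apply: pX'; apply: contrapT => nI; apply: nf; exists f.
  have [|f1 Sf1 nf1] := wit S1 _ n1; first by rewrite eV; exact: subsetUl.
  have [|f2 Sf2 nf2] := wit S2 _ n2; first by rewrite eV; exact: subsetUr.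
  have /pX[] // : vanishing_ideal X (f1 * f2).
  move=> p /sub_zariski_closure; rewrite eV pevalM => -[/(_ _ Sf1) ->|/(_ _ Sf2) ->].
    by rewrite mul0r.
  by rewrite mulr0.
Qed.

Lemma irreducible_component_self V : irreducible V -> forall Z : set point,
  irreducible_component V Z <-> Z = V.
Proof.
move=> iV Z; split => [[iZ ZV max]|->]; first by rewrite (max V).
by split => // W _ VW WV; apply/seteqP.
Qed.

End PrimeChains.

(** * Positive definite matrices *)

Section QuadraticForms.
Variables (R : realType) (n : nat).
Implicit Types (A B C P U : 'M[R]_n) (v w : 'rV[R]_n).

Definition bil A v w : R := (v *m A *m w^T) 0 0.

Definition psd A : Prop := A^T = A /\ forall v, 0 <= bil A v v.

Lemma bilDl A u v w : bil A (u + v) w = bil A u w + bil A v w.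
Proof. by rewrite /bil !mulmxDl mxE. Qed.

Lemma bilDr A u v w : bil A u (v + w) = bil A u v + bil A u w.
Proof. by rewrite /bil linearD /= !mulmxDr mxE. Qed.

Lemma bilZl A a u v : bil A (a *: u) v = a * bil A u v.
Proof. by rewrite /bil -!scalemxAl mxE. Qed.

Lemma bilZr A a u v : bil A u (a *: v) = a * bil A u v.
Proof. by rewrite /bil linearZ /= -!scalemxAr mxE. Qed.

Lemma bilC A u v : A^T = A -> bil A u v = bil A v u.
Proof.
move=> As; rewrite /bil -[u *m A *m _]trmxK mxE !trmx_mul trmxK As.
by rewrite mulmxA.
Qed.

Lemma bilDm A B u v : bil (A + B) u v = bil A u v + bil B u v.
Proof. by rewrite /bil mulmxDr mulmxDl mxE. Qed.

Lemma bilZm A a u v : bil (a *: A) u v = a * bil A u v.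
Proof. by rewrite /bil -scalemxAr -scalemxAl mxE. Qed.

Lemma bilE A u v : bil A u v = \sum_i \sum_j u 0 i * A i j * v 0 j.
Proof.
rewrite /bil mxE exchange_big; apply: eq_bigr => j _ /=.
by rewrite !mxE big_distrl.
Qed.

Lemma bil_delta A i j : bil A (delta_mx 0 i) (delta_mx 0 j) = A i j.
Proof. by rewrite /bil -rowE trmx_delta -colE !mxE. Qed.

Lemma bil_deltar A v j : bil A v (delta_mx 0 j) = (v *m A) 0 j.
Proof. by rewrite /bil trmx_delta -colE !mxE. Qed.

Lemma posdef_psd A : posdef A -> psd A.
Proof.
move=> [As Ap]; split=> // v; have [->|/Ap/ltW//] := eqVneq v 0.
by rewrite /bil !mul0mx mxE.
Qed.

Lemma bil_line A u v t : A^T = A ->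
  bil A (u + t *: v) (u + t *: v) = bil A u u + 2 * t * bil A u v + t ^+ 2 * bil A v v.
Proof.
by move=> As; rewrite !(bilDl, bilDr, bilZl, bilZr) (bilC v u As); ring.
Qed.

Lemma cauchy_schwarz A u v : psd A ->
  bil A u v ^+ 2 <= bil A u u * bil A v v.
Proof.
move=> [As Ap]; set a := bil A u u; set b := bil A u v; set c := bil A v v.
have pos t : 0 <= a + 2 * t * b + t ^+ 2 * c by rewrite -bil_line.
have c0 : 0 <= c by exact: Ap.
have [c_eq0|c_neq0] := eqVneq c 0.
  have [->|b0] := eqVneq b 0; first by rewrite c_eq0 mulr0 expr0n.
  (* For [c = 0] the quadratic is affine in [t]; this [t] gives it the value -1. *)
  have := pos (- (a + 1) / (2 * b)); rewrite c_eq0 mulr0 addr0.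
  rewrite (_ : 2 * _ * b = - (a + 1)); last by field.
  lra.
have c_gt0 : 0 < c by rewrite lt_neqAle eq_sym c_neq0.
(* The vertex of the parabola. *)
have := pos (- b / c).
rewrite (_ : _ + _ = (a * c - b ^+ 2) / c); last by field.
by rewrite pmulr_lge0 ?invr_gt0// subr_ge0.
Qed.

Lemma psd_ker A v : psd A -> bil A v v = 0 -> v *m A = 0.
Proof.
move=> Ap v0; apply/rowP => j; rewrite -bil_deltar [RHS]mxE.
have := cauchy_schwarz v (delta_mx 0 j) Ap; rewrite v0 mul0r => h.
by apply/eqP; rewrite -sqrf_eq0 eq_le h sqr_ge0.
Qed.

Lemma psd_row0 A i : psd A -> A i i = 0 -> row i A = 0.
Proof. by move=> Ap; rewrite -bil_delta rowE => /psd_ker; apply. Qed.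

(** Induction on the number of nonzero rows, splitting off rank one matrices as in the Cholesky
    decomposition. *)
Lemma psd_rank1_sum A : psd A ->
  exists s : seq 'rV[R]_n, A = \sum_(v <- s) v^T *m v.
Proof.
have [k] := ubnP #|[set i | row i A != 0]%SET|; elim: k A => // k IH A Ak Ap.
have [i Ai|A0] := pickP (fun i => row i A != 0); last first.
  exists [::]; rewrite big_nil; apply/row_matrixP => i.
  by rewrite row0; apply/eqP; move: (A0 i) => /negbFE.
have [As Age0] := Ap.
have Aii : A i i != 0 by apply: contra_neq Ai; exact: psd_row0.
have Aii0 : 0 < A i i by rewrite lt_neqAle eq_sym Aii -bil_delta Age0.
(* The Schur complement at the pivot [A i i]: it is psd by Cauchy-Schwarz, its row [i] vanishes, and
   zero rows of [A] stay zero. *)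
pose r := row i A; pose B := A - (A i i)^-1 *: (r^T *m r).
have bilB v : bil B v v = bil A v v - (A i i)^-1 * ((v *m A) 0 i) ^+ 2.
  rewrite /B bilDm -scaleNr bilZm mulNr; congr (_ - _ * _).
  rewrite /bil mulmxA -mulmxA -{2}[r]trmxK -trmx_mul.
  have -> : v *m r^T = (((v *m A) 0 i)%:M : 'M[R]_1).
    rewrite [LHS]mx11_scalar; congr (_%:M).
    by rewrite -[RHS]bil_deltar /bil /r rowE trmx_mul As mulmxA.
  by rewrite tr_scalar_mx -scalar_mxM mxE eqxx mulr1n expr2.
have Bs : B^T = B by rewrite /B linearB linearZ /= trmx_mul trmxK As.
have Bp : psd B.
  split => // v; rewrite bilB -bil_deltar subr_ge0 mulrC ler_pdivrMr//.
  by rewrite -[X in _ * X]bil_delta; exact: cauchy_schwarz.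
have rowB j : row j B = row j A - (A j i / A i i) *: row i A.
  apply/rowP => l; rewrite !mxE; congr (_ - _).
  rewrite big_ord1 !mxE -[in A i j]As mxE.
  by field.
have [|s Bsum] := IH B _ Bp.
  rewrite -ltnS; apply: leq_trans Ak; rewrite ltnS; apply: proper_card; apply/properP; split.
    apply/fintype.subsetP => j; rewrite !inE rowB; apply: contra_neq => Aj0.
    rewrite Aj0; have -> : A j i = 0 by have /rowP/(_ i) := Aj0; rewrite !mxE.
    by rewrite mul0r scale0r subr0.
  by exists i; rewrite !inE// rowB divff// scale1r subrr eqxx.
have Ahalf : ((Num.sqrt (A i i))^-1 *: r)^T *m ((Num.sqrt (A i i))^-1 *: r)
    = (A i i)^-1 *: (r^T *m r).
  rewrite [(_ *: r)^T]linearZ /= -scalemxAl -scalemxAr scalerA -invfM -expr2 sqr_sqrtr//.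
  exact: ltW.
exists ((Num.sqrt (A i i))^-1 *: r :: s).
by rewrite big_cons Ahalf -Bsum /B addrC subrK.
Qed.

Lemma tr_rank1 A v : \tr (A *m (v^T *m v)) = bil A v v.
Proof. by rewrite mulmxA mxtrace_mulC mulmxA trace_mx11. Qed.

(** On rank one summands of [P] the trace is a value of the form [A]; a vanishing sum of nonnegative
    values leaves only zero vectors. *)
Lemma tr_posdef_eq0 A P : posdef A -> psd P -> \tr (A *m P) = 0 -> P = 0.
Proof.
move=> Ap /psd_rank1_sum[s ->].
have [_ Age0] := posdef_psd Ap.
rewrite mulmx_sumr raddf_sum /= (eq_bigr (fun v => bil A v v)); last first.
  by move=> v _; rewrite tr_rank1.
elim: s => [|v s IH]; first by rewrite !big_nil.
rewrite !big_cons => /eqP; rewrite paddr_eq0 //; last by apply: sumr_ge0.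
move=> /andP[/eqP vv /eqP/IH ->]; rewrite addr0.
have [->|v0] := eqVneq v 0; first by rewrite mulmx0.
by have := Ap.2 v v0; rewrite -/(bil A v v) vv ltxx.
Qed.

(** [U C U] is psd, hence zero by the trace, so the form [C] vanishes on the rows of [U]. This
    positivity is behind both the uniqueness of completions and transversality. *)
Lemma posdef_sandwich_eq0 A C U : posdef A -> posdef C -> U^T = U ->
  \tr (A *m U *m C *m U) = 0 -> U = 0.
Proof.
move=> Ap Cp Us; rewrite -!mulmxA => /(tr_posdef_eq0 Ap).
have E v w : bil (U *m (C *m U)) v w = bil C (v *m U) (w *m U).
  by rewrite /bil trmx_mul Us !mulmxA.
have [Cs Cge0] := posdef_psd Cp.
move=> UCU; have {}UCU : U *m (C *m U) = 0.
  by apply: UCU; split => [|v]; rewrite ?E // !trmx_mul Cs Us mulmxA.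
apply/row_matrixP => i; rewrite row0 rowE; apply/eqP/negPn/negP => /(Cp.2).
by rewrite -/(bil C _ _) -E UCU /bil mulmx0 mul0mx mxE ltxx.
Qed.

Lemma posdef1 : posdef (1%:M : 'M[R]_n).
Proof.
split => [|v v0]; first by rewrite tr_scalar_mx.
rewrite mulmx1 mxE lt_neqAle sumr_ge0 ?andbT; last first.
  by move=> i _; rewrite mxE -expr2 sqr_ge0.
apply: contraNneq v0 => /esym/eqP; rewrite psumr_eq0 => [/allP h|i _]; last first.
  by rewrite mxE -expr2 sqr_ge0.
apply/eqP/rowP => i; have := h i (mem_index_enum _); rewrite !mxE.
by rewrite -expr2 sqrf_eq0 => /eqP.
Qed.

Lemma posdef_convex A B t : 0 <= t <= 1 -> posdef A -> posdef B ->
  posdef ((1 - t) *: A + t *: B).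
Proof.
move=> /andP[t0 t1] [As Ap] [Bs Bp]; split.
  by rewrite linearD !linearZ /= As Bs.
move=> v v0; rewrite -/(bil _ v v) bilDm !bilZm.
have := Ap v v0; have := Bp v v0; rewrite -/(bil _ v v) -/(bil A v v) => b a.
have [t_gt0|t_le0] := ltP 0 t.
  by apply: ltr_wpDl; [apply: mulr_ge0; [lra | exact: ltW] | exact: mulr_gt0].
have -> : t = 0 by apply/eqP; rewrite eq_le t_le0.
by rewrite subr0 mul1r mul0r addr0.
Qed.

Lemma posdef_det_neq0 A : posdef A -> \det A != 0.
Proof.
move=> [_ Ap]; apply/det0P => -[v v0 vA].
by have := Ap v v0; rewrite vA mul0mx mxE ltxx.
Qed.

(** The segment from the identity to [A] stays positive definite, so the determinant has no zero on
    it and keeps its sign. *)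
Lemma posdef_det_gt0 A : posdef A -> 0 < \det A.
Proof.
move=> Ap; have nz := posdef_det_neq0 Ap.
rewrite lt_neqAle eq_sym nz /= leNgt; apply/negP => A0.
pose M : 'M[{poly R}]_n := map_mx polyC 1%:M + 'X *: map_mx polyC (A - 1%:M).
have ME t : (\det M).[t] = \det ((1 - t) *: 1%:M + t *: A).
  have -> : (\det M).[t] = horner_eval t (\det M) by [].
  rewrite -det_map_mx; congr (\det _); apply/matrixP => i j.
  by rewrite !mxE /= /horner_eval !hornerE; ring.
have [||t /andP[t0 t1] /eqP] := @poly_ivt _ (- \det M) 0 1; first exact: ler01.
  rewrite !hornerN !ME subr0 scale1r scale0r addr0 det1 subrr scale0r scale1r add0r.
  by rewrite oppr_le0 ler01 oppr_ge0 ltW.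
rewrite hornerN ME => /eqP; rewrite oppr_eq0; apply/negP.
apply: posdef_det_neq0; apply: posdef_convex => //; first by rewrite t0.
exact: posdef1.
Qed.

Lemma posdef_unit A : posdef A -> A \in unitmx.
Proof. by move=> /posdef_det_neq0; rewrite unitmxE unitfE. Qed.

Lemma posdef_inv A : posdef A -> posdef (invmx A).
Proof.
move=> Ap; have Au := posdef_unit Ap; have [As Apos] := Ap.
split; first by rewrite trmx_inv As.
move=> v v0; have : 0 < bil A (v *m invmx A) (v *m invmx A).
  apply: Apos; apply: contra_neq v0 => /(congr1 (fun w => w *m A)).
  by rewrite mulmxKV// mul0mx.
by rewrite /bil mulmxKV// trmx_mul trmx_inv As mulmxA.
Qed.

Lemma posdef_adj A : posdef A -> posdef (\adj A).
Proof.
move=> Ap; have d0 := posdef_det_gt0 Ap.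
have -> : \adj A = \det A *: invmx A.
  by rewrite /invmx posdef_unit// scalerA divff ?scale1r// gt_eqF.
have [Ks Kp] := posdef_inv Ap; split; first by rewrite linearZ /= Ks.
by move=> v v0; rewrite -/(bil _ v v) bilZm mulr_gt0// Kp.
Qed.

Lemma psd_posdef A : psd A -> \det A != 0 -> posdef A.
Proof.
move=> Ap A0; have [As Age0] := Ap; split=> // v v0.
rewrite lt_neqAle [X in _ && X]Age0 andbT eq_sym.
apply: contra_neq v0 => /(psd_ker Ap) vA; apply/eqP; apply: contraNT A0 => v0.
by apply/det0P; exists v.
Qed.

(** The form is evaluated at the sum and the difference of two basis vectors. *)
Lemma psd_entry A i j : psd A -> 2 * `|A i j| <= A i i + A j j.
Proof.
move=> [As Ap]; have h t : 0 <= A i i + 2 * t * A i j + t ^+ 2 * A j j.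
  by rewrite -!bil_delta -bil_line.
have := h 1; have := h (- 1); case: (ger0P (A i j)) => _; lra.
Qed.

(** The form [B] is bounded in absolute value by a multiple [c] of the form [A], and [1 / c] is the
    radius. *)
Lemma posdef_line A B : posdef A -> B^T = B ->
  exists2 e : R, 0 < e & forall t : R, `|t| < e -> posdef (A + t *: B).
Proof.
move=> Ap Bs; have [As Apos] := Ap; have Apsd := posdef_psd Ap.
pose K := invmx A; have Au := posdef_unit Ap.
have [Ks Kge0] := posdef_psd (posdef_inv Ap).
(* Cauchy-Schwarz for the form [A], applied to [v] and row [i] of the inverse. *)
have coord v i : (v 0 i) ^+ 2 <= bil A v v * K i i.
  have -> : v 0 i = bil A v (delta_mx 0 i *m K).
    by rewrite /bil trmx_mul Ks mulmxA mulmxK// trmx_delta -colE mxE.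
  suff -> : K i i = bil A (delta_mx 0 i *m K) (delta_mx 0 i *m K) by exact: cauchy_schwarz.
  by rewrite /bil mulmxKV// trmx_mul Ks mulmxA -/(bil _ _ _) bil_delta.
(* The summand 1 keeps [c] positive when [B = 0]. *)
pose c := \sum_i \sum_j `|B i j| * (K i i + K j j) + 1.
have Kii i : 0 <= K i i by rewrite -bil_delta.
have c0 : 0 < c.
  rewrite /c ltr_wpDl//; apply: sumr_ge0 => i _; apply: sumr_ge0 => j _.
  by rewrite mulr_ge0// addr_ge0.
have bound v : `|bil B v v| <= c * bil A v v.
  rewrite bilE /c mulrDl big_distrl /= -[leLHS]addr0; apply: lerD; last first.
    by rewrite mul1r Apsd.2.
  apply: (le_trans (ler_norm_sum _ _ _)); apply: ler_sum => i _.
  rewrite big_distrl /=; apply: (le_trans (ler_norm_sum _ _ _)); apply: ler_sum => j _.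
  rewrite mulrAC normrM mulrC -mulrA ler_wpM2l// normrM.
  have := coord v i; have := coord v j; rewrite -[(v 0 i) ^+ 2]real_normK ?num_real//.
  rewrite -[(v 0 j) ^+ 2]real_normK ?num_real//.
  have : 0 <= (`|v 0 i| - `|v 0 j|) ^+ 2 by apply: sqr_ge0.
  have := normr_ge0 (v 0 i); have := normr_ge0 (v 0 j).
  set a := `|v 0 i|; set b := `|v 0 j|; nra.
exists c^-1; first by rewrite invr_gt0.
move=> t tc; split; first by rewrite linearD linearZ /= As Bs.
move=> v v0; rewrite -/(bil _ v v) bilDm bilZm.
have A0 : 0 < bil A v v := Apos v v0.
have : `|t * bil B v v| < bil A v v.
  rewrite normrM; apply: (le_lt_trans (ler_wpM2l _ (bound v))) => //.
  rewrite mulrA -[ltRHS]mul1r ltr_pM2r// -ltr_pdivlMr// div1r//.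
by rewrite ltr_norml => /andP[h _]; lra.
Qed.

End QuadraticForms.

(** * Coordinates on symmetric matrices *)

Section SymmetricCoordinates.
Variable n : nat.
Local Notation m := (sym_dim n).

Lemma sorted_pair_subproof (i j : 'I_n) :
  ((if (i <= j)%N then (i, j) else (j, i)).1 <= (if (i <= j)%N then (i, j) else (j, i)).2)%N.
Proof. by case: ifPn => /=; rewrite -?ltnNge => // /ltnW. Qed.

(** One coordinate serves the positions [(i, j)] and [(j, i)]; [pidx] returns the sorted pair. *)
Definition kidx (i j : 'I_n) : 'I_m :=
  enum_rank (exist (fun p : 'I_n * 'I_n => (p.1 <= p.2)%N) _ (sorted_pair_subproof i j)
             : sym_index n).

Definition pidx (k : 'I_m) : 'I_n * 'I_n := val (enum_val k).

Lemma pidx_le k : ((pidx k).1 <= (pidx k).2)%N.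
Proof. exact: (valP (enum_val k)). Qed.

Lemma pidx_kidx i j : pidx (kidx i j) = if (i <= j)%N then (i, j) else (j, i).
Proof. by rewrite /pidx /kidx enum_rankK. Qed.

Lemma kidxK k : kidx (pidx k).1 (pidx k).2 = k.
Proof.
apply: enum_val_inj; apply: val_inj; rewrite -[LHS]/(pidx _) pidx_kidx pidx_le.
by rewrite -surjective_pairing.
Qed.

Lemma kidxC i j : kidx i j = kidx j i.
Proof.
apply: enum_val_inj; apply: val_inj; rewrite -[LHS]/(pidx _) -[RHS]/(pidx _) !pidx_kidx.
by case: ltngtP => // /val_inj ->.
Qed.

Definition symmx (A : Type) (x : 'rV[A]_m) : 'M[A]_n := \matrix_(i, j) x 0 (kidx i j).

Lemma symmx_tr A (x : 'rV[A]_m) : (symmx x)^T = symmx x.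
Proof. by apply/matrixP => i j; rewrite !mxE kidxC. Qed.

Lemma symmx_pidx A (x : 'rV[A]_m) k : symmx x (pidx k).1 (pidx k).2 = x 0 k.
Proof. by rewrite mxE kidxK. Qed.

Lemma sym_coordK (R : realType) (x : 'rV[R]_m) : sym_coord (symmx x) = x.
Proof. by apply/rowP => k; rewrite [LHS]mxE; exact: symmx_pidx. Qed.

Lemma symmxK (R : realType) (B : 'M[R]_n) : B^T = B -> symmx (sym_coord B) = B.
Proof.
move=> Bs; apply/matrixP => i j; rewrite !mxE -/(pidx _) pidx_kidx.
by case: leqP => // _ /=; rewrite -[in LHS]Bs mxE.
Qed.

Lemma map_symmx (A B : Type) (f : A -> B) (x : 'rV[A]_m) :
  map_mx f (symmx x) = symmx (map_mx f x).
Proof. by apply/matrixP => i j; rewrite !mxE. Qed.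

Section Ring.
Variable A : comNzRingType.
Implicit Types (x y u v : 'rV[A]_m).

Lemma symmxD u v : symmx (u + v) = symmx u + symmx v.
Proof. by apply/matrixP => i j; rewrite !mxE. Qed.

Lemma symmxZ a u : symmx (a *: u) = a *: symmx u.
Proof. by apply/matrixP => i j; rewrite !mxE. Qed.

Lemma symmxB u v : symmx (u - v) = symmx u - symmx v.
Proof. by apply/matrixP => i j; rewrite !mxE. Qed.

Lemma symmx_sum_delta u : symmx u = \sum_j u 0 j *: symmx (delta_mx 0 j).
Proof.
apply/matrixP => i j; rewrite summxE mxE (bigD1 (kidx i j)) //= big1 => [|k kij].
  by rewrite !mxE !eqxx mulr1 addr0.
by rewrite !mxE /= eq_sym (negPf kij) mulr0.
Qed.

(* [X^-1 - Y^-1 = - X^-1 (X - Y) Y^-1] exactly, so that [adj_form x y (x - y)]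
   is an exact difference quotient for the equations [adj_zero].  The product is
   symmetrized because [symmx] only sees the entries above the diagonal. *)
Definition adj_form x y u : 'M[A]_n :=
  \adj (symmx x) *m symmx u *m \adj (symmx y)
  + \adj (symmx y) *m symmx u *m \adj (symmx x).

Lemma adj_form_sum x y u : adj_form x y u = \sum_j u 0 j *: adj_form x y (delta_mx 0 j).
Proof.
rewrite /adj_form {1 2}(symmx_sum_delta u) !(mulmx_sumr, mulmx_suml) -big_split /=.
by apply: eq_bigr => j _; rewrite -!(scalemxAl, scalemxAr) scalerDr.
Qed.

Lemma adj_tr (M : 'M[A]_n) : M^T = M -> (\adj M)^T = \adj M.
Proof. by move=> Ms; rewrite trmx_adj Ms. Qed.

Lemma adj_form_tr x y u : (adj_form x y u)^T = adj_form x y u.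
Proof.
rewrite /adj_form linearD /= !trmx_mul !adj_tr ?symmx_tr// addrC.
by rewrite !mulmxA.
Qed.

(** The identity for a difference of inverses with the denominators cleared. *)
Lemma adj_diff (M N : 'M[A]_n) :
  \adj M *m (M - N) *m \adj N = \det M *: \adj N - \det N *: \adj M.
Proof.
rewrite mulmxBr mul_adj_mx mulmxBl mul_scalar_mx; congr (_ - _).
by rewrite -mulmxA mul_mx_adj mul_mx_scalar.
Qed.

Variable S : pred 'I_m.

(** At a zero [x = y] of the equations the rows in [S] are multiples of the differentials of the
    adjugate entries; the other rows are coordinates. For two different zeros the matrix acts as an
    exact difference quotient. *)
Definition jac_mx x y : 'M[A]_m := \matrix_(k, j)
  if S k then adj_form x y (delta_mx 0 j) (pidx k).1 (pidx k).2 else (k == j)%:R.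

Lemma jac_mx_mul x y u k :
  (jac_mx x y *m u^T) k 0 =
  if S k then adj_form x y u (pidx k).1 (pidx k).2 else u 0 k.
Proof.
rewrite mxE; case: ifPn => Sk.
  rewrite adj_form_sum summxE; apply: eq_bigr => j _.
  by rewrite !mxE Sk mulrC.
rewrite (bigD1 k) //= big1 => [|j jk]; rewrite !mxE (negPf Sk).
  by rewrite eqxx mul1r addr0.
by rewrite eq_sym (negPf jk) mul0r.
Qed.

Definition adj_zero x := forall k, S k -> \adj (symmx x) (pidx k).1 (pidx k).2 = 0.

Lemma jac_mx_diff x y : adj_zero x -> adj_zero y ->
  jac_mx x y *m (x - y)^T = \col_k if S k then 0 else (x - y) 0 k.
Proof.
move=> hx hy; apply/colP => k; rewrite jac_mx_mul [RHS]mxE; case: ifPn => // Sk.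
have sx := symmx_tr x; have sy := symmx_tr y.
have -> : adj_form x y (x - y) = 2 *: (\det (symmx x) *: \adj (symmx y)
     - \det (symmx y) *: \adj (symmx x)).
  rewrite /adj_form symmxB adj_diff scaler_nat mulr2n; congr (_ + _).
  by rewrite -[symmx x - symmx y]opprB mulmxN mulNmx adj_diff opprB.
move: (hx k Sk) (hy k Sk); move: (\adj (symmx x)) (\adj (symmx y)) => M N hM hN.
by rewrite !mxE hM hN !mulr0 subrr mulr0.
Qed.

End Ring.

Lemma map_adj_form (A B : comNzRingType) (f : {rmorphism A -> B}) (x y u : 'rV[A]_m) :
  map_mx f (adj_form x y u) = adj_form (map_mx f x) (map_mx f y) (map_mx f u).
Proof. by rewrite /adj_form map_mxD !map_mxM !map_mx_adj !map_symmx. Qed.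

Lemma map_jac_mx (A B : comNzRingType) (f : {rmorphism A -> B}) S (x y : 'rV[A]_m) :
  map_mx f (jac_mx S x y) = jac_mx S (map_mx f x) (map_mx f y).
Proof.
apply/matrixP => k j; rewrite mxE [in LHS]mxE [RHS]mxE; case: ifP => _; last by rewrite rmorph_nat.
by rewrite -(map_delta_mx f) -map_adj_form [RHS]mxE.
Qed.

Lemma tr_sandwich_sym (A : comNzRingType) (M N U : 'M[A]_n) :
  \tr ((M *m U *m N + N *m U *m M) *m U) = 2 * \tr (M *m U *m N *m U).
Proof.
rewrite mulmxDl mxtraceD mulr_natl mulr2n; congr (_ + _).
by rewrite -[N *m U *m M *m U]mulmxA mxtrace_mulC !mulmxA.
Qed.

Section Model.
Variables (R : realType) (S Z : pred 'I_m).
Implicit Types (x y u : 'rV[R]_m).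

(** A kernel vector [u] vanishes outside [S], and [adj_form x y u] vanishes on [S]. Hence the trace
    of the product of their matrices is 0, and [posdef_sandwich_eq0] gives [u = 0]. *)
Lemma jac_mx_unit x y : (forall i, ~~ S (kidx i i)) ->
  posdef (symmx x) -> posdef (symmx y) -> jac_mx S x y \in unitmx.
Proof.
move=> Sdiag px py; rewrite unitmxE unitfE -det_tr; apply/det0P => -[u u0].
move=> /(congr1 trmx); rewrite trmx_mul trmxK trmx0 => Ju.
move/eqP: u0; apply; suff U0 : symmx u = 0.
  by apply/rowP => k; rewrite -[u]sym_coordK U0 !mxE /= !mxE.
apply: (posdef_sandwich_eq0 (posdef_adj px) (posdef_adj py) (symmx_tr u)).
suff : \tr (adj_form x y u *m symmx u) = 0.
  by rewrite tr_sandwich_sym => /eqP; rewrite mulf_eq0 pnatr_eq0 => /eqP.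
rewrite /mxtrace big1 // => i _; rewrite mxE big1 // => j _.
have := congr1 (fun w : 'cV_m => w (kidx i j) 0) Ju; rewrite jac_mx_mul [RHS]mxE pidx_kidx.
rewrite [symmx u j i]mxE [kidx j i]kidxC; case: ifP => _; last by move->; rewrite mulr0.
by case: leqP => _ /= h; rewrite ?h ?mul0r // -adj_form_tr mxE h mul0r.
Qed.

(** [S] marks zeros of the inverse, [Z] zeros of the matrix; the adjugate replaces the inverse to
    keep the equations polynomial. *)
Definition dmset : set 'rV[R]_m :=
  [set x | [/\ posdef (symmx x), adj_zero S x & forall k, Z k -> x 0 k = 0]].

(** The difference quotient matrix is invertible and sends [x - y] to 0. *)
Lemma dmset_unique x y : (forall i, ~~ S (kidx i i)) -> dmset x -> dmset y ->
  (forall k, ~~ S k -> x 0 k = y 0 k) -> x = y.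
Proof.
move=> Sdiag [px ax _] [py ay _] xy; apply/eqP; rewrite -subr_eq0; apply/eqP.
apply: trmx_inj; rewrite trmx0; apply: (can_inj (mulKmx (jac_mx_unit Sdiag px py))).
rewrite mulmx0 jac_mx_diff//; apply/colP => k; rewrite !mxE.
by case: ifPn => // /xy ->; rewrite subrr.
Qed.

End Model.
End SymmetricCoordinates.

(** * Derivatives of the adjugate of the generic symmetric matrix *)

Section PolynomialMatrices.
Variables (R : realType) (n : nat).
Local Notation m := (sym_dim n).
Local Notation poly_m := (mpoly.mpoly m R).

Definition varrow : 'rV[poly_m]_m := \row_k mpoly.mpolyX R (mpoly.mnm1 k).

Definition symvar : 'M[poly_m]_n := symmx varrow.

Lemma peval_varrow (p : 'rV[R]_m) : map_mx (mpoly.meval (p 0)) varrow = p.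
Proof. by apply/rowP => k; rewrite !mxE; exact: mpoly.mevalXU. Qed.

Lemma peval_symvar (p : 'rV[R]_m) : map_mx (mpoly.meval (p 0)) symvar = symmx p.
Proof. by rewrite map_symmx peval_varrow. Qed.

Lemma peval_det (p : 'rV[R]_m) : peval (\det symvar) p = \det (symmx p).
Proof. by rewrite /peval -det_map_mx peval_symvar. Qed.

Lemma peval_adj (p : 'rV[R]_m) i j : peval (\adj symvar i j) p = \adj (symmx p) i j.
Proof. by rewrite -peval_symvar -map_mx_adj [RHS]mxE. Qed.

Lemma peval_jac S (p : 'rV[R]_m) :
  map_mx (mpoly.meval (p 0)) (jac_mx S varrow varrow) = jac_mx S p p.
Proof. by rewrite map_jac_mx peval_varrow. Qed.

Lemma mderiv_mulmx l j (A B : 'M[poly_m]_l) :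
  map_mx (mpoly.mderiv j) (A *m B) =
  map_mx (mpoly.mderiv j) A *m B + A *m map_mx (mpoly.mderiv j) B.
Proof.
apply/matrixP => a b; rewrite !mxE raddf_sum /= -big_split /=.
by apply: eq_bigr => c _; rewrite mpoly.mderivM !mxE.
Qed.

Lemma mderiv_var j k :
  mpoly.mderiv j (mpoly.mpolyX R (mpoly.mnm1 k) : poly_m) = (k == j)%:R.
Proof.
rewrite mpoly.mderivX mpoly.mnm1E; case: eqP => [->|_]; last by rewrite scale0r.
by rewrite scale1r -{1}[mpoly.mnm1 j]mpoly.add0m mpoly.addmK mpoly.mpolyX0.
Qed.

Lemma mderiv_symvar j : map_mx (mpoly.mderiv j) symvar = symmx (delta_mx 0 j).
Proof.
by rewrite map_symmx; congr symmx; apply/rowP => k; rewrite !mxE mderiv_var.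
Qed.

(** Differentiate the product of the generic matrix with its adjugate, then multiply by the adjugate
    on the left. *)
Lemma mderiv_adj j :
  \adj symvar *m symmx (delta_mx 0 j) *m \adj symvar
    + \det symvar *: map_mx (mpoly.mderiv j) (\adj symvar)
  = mpoly.mderiv j (\det symvar) *: \adj symvar.
Proof.
have := congr1 (map_mx (mpoly.mderiv j)) (mul_mx_adj symvar).
rewrite mderiv_mulmx mderiv_symvar => /(congr1 (fun M => \adj symvar *m M)).
rewrite mulmxDr !mulmxA mul_adj_mx mul_scalar_mx => ->.
rewrite (_ : map_mx _ _ = (mpoly.mderiv j (\det symvar))%:M) ?mul_mx_scalar//.
by apply/matrixP => a b; rewrite !mxE; case: eqP => //= _; rewrite ?mulr0n ?mpoly.mderiv0.
Qed.

Lemma peval_mderiv_adj (p : 'rV[R]_m) j a b : \adj (symmx p) a b = 0 ->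
  \det (symmx p) * peval (mpoly.mderiv j (\adj symvar a b)) p
  = - (\adj (symmx p) *m symmx (delta_mx 0 j) *m \adj (symmx p)) a b.
Proof.
move=> ab0; have := congr1 (map_mx (mpoly.meval (p 0))) (mderiv_adj j).
rewrite map_mxD !map_mxZ !map_mxM !map_mx_adj [map_mx _ (symmx (delta_mx _ _))]map_symmx.
rewrite map_delta_mx -det_map_mx !peval_symvar.
move=> /matrixP/(_ a b); rewrite [LHS]mxE [RHS]mxE ab0 mulr0 => /eqP.
rewrite addr_eq0 => /eqP ->; rewrite opprK [RHS]mxE; congr (_ * _).
by rewrite [RHS]mxE [map_mx (mpoly.mderiv j) _ a b]mxE.
Qed.

End PolynomialMatrices.

(** * Limits of polynomials and compactness *)

(** If [F] misses the preimage of a neighbourhood, restrict [F] to the complement of that preimage;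
    an ultrafilter extending the restriction contradicts the hypothesis. *)
Lemma cvg_ultra (T : Type) (U : topologicalType) (F : set_system T) (y : T -> U) (x : U) :
  Filter F -> (forall G : set_system T, UltraFilter G -> F `<=` G -> y @ G --> x) ->
  y @ F --> x.
Proof.
move=> FF ultra A xA; apply: contrapT => nFA.
pose D := ~` (y @^-1` A).
have wP : ProperFilter (within D F).
  apply: Build_ProperFilter ; rewrite /within /= => h; apply: nFA.
  by apply: filterS h => t; rewrite /D /= => h; apply: contrapT => /h.
have [G [GU wG]] := ultraFilterLemma wP.
have FG : F `<=` G by move=> B FB; apply: wG; apply: filterS FB => t Bt _.
have GA : G (y @^-1` A) := ultra G GU FG A xA.
have GD : G D by apply: wG; apply: filterS (@filterT _ F _).
have [t [? ?]] : (y @^-1` A `&` D) !=set0 by apply: (@filter_ex _ G); exact: filterI.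
by [].
Qed.

(** The image of an ultrafilter is an ultrafilter, and one containing a compact set converges to a
    point of it. *)
Lemma ultra_compact_limit (T : Type) (U : topologicalType) (F : set_system T)
    (y : T -> U) (A : set U) :
  UltraFilter F -> compact A -> F [set t | A (y t)] -> exists2 z, A z & y @ F --> z.
Proof.
move=> FU; rewrite compact_ultra => cA Fy; case: (cA (y @ F)); first last.
- by move=> z [cz yz]; exists z.
- exact: Fy.
- split; first exact: fmap_proper_filter.
  move=> G GP sG; apply/seteqP; split; last exact: sG.
  move=> B GB; rewrite /fmap /=.
  have [//|h] := in_ultra_setVsetC (y @^-1` B) FU.
  have /sG GnB : (y @ F) (~` B) by [].
  have GF : Filter G by exact: filter_filter.
  by have [t []] := @filter_ex _ G GP _ (@filterI _ _ GF _ _ GB GnB).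
Qed.

Section PolynomialContinuity.
Variables (R : realType) (m : nat).
Local Notation poly_m := (mpoly.mpoly m R).

Lemma mpoly_ring_ind (P : poly_m -> Prop) :
  (forall c, P (mpoly.mpolyC m c)) -> (forall k, P (mpoly.mpolyX R (mpoly.mnm1 k))) ->
  (forall f g, P f -> P g -> P (f + g)) -> (forall f g, P f -> P g -> P (f * g)) ->
  forall f, P f.
Proof.
move=> PC PX PD PM f; rewrite [f]mpoly.mpolyE.
have P0 : P 0 by have := PC 0; rewrite mpoly.mpolyC0.
have P1 : P 1 by have := PC 1; rewrite mpoly.mpolyC1.
apply: big_ind => // a _; rewrite -mpoly.mul_mpolyC; apply: (PM) => //.
rewrite mpoly.mpolyXE_id; apply: big_ind => [//|f' g'|i _]; first exact: PM.
elim: (mpoly.fun_of_multinom a i) => [|e IH]; first by rewrite expr0.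
by rewrite exprS; apply: (PM).
Qed.

Lemma pevalC c (p : 'rV[R]_m) : peval (mpoly.mpolyC m c) p = c.
Proof. exact: mpoly.mevalC. Qed.

Lemma pevalX k (p : 'rV[R]_m) : peval (mpoly.mpolyX R (mpoly.mnm1 k)) p = p 0 k.
Proof. exact: mpoly.mevalXU. Qed.

Lemma pevalZ c (f : poly_m) (p : 'rV[R]_m) : peval (c *: f) p = c * peval f p.
Proof. exact: mpoly.mevalZ. Qed.

Lemma peval_sum I (r : seq I) P (F : I -> poly_m) (p : 'rV[R]_m) :
  peval (\sum_(i <- r | P i) F i) p = \sum_(i <- r | P i) peval (F i) p.
Proof. exact: raddf_sum. Qed.

Lemma peval_cvg (T : Type) (F : set_system T) (y : T -> 'rV[R]_m) (x : 'rV[R]_m)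
    (f : poly_m) : Filter F ->
  (forall k, y t 0 k @[t --> F] --> x 0 k) -> peval f (y t) @[t --> F] --> peval f x.
Proof.
move=> FF yx; elim/mpoly_ring_ind: f => [c|k|f g hf hg|f g hf hg].
- under eq_fun do rewrite pevalC; rewrite pevalC; exact: cvg_cst.
- under eq_fun do rewrite pevalX; rewrite pevalX; exact: yx.
- under eq_fun do rewrite pevalD; rewrite pevalD; exact: cvgD.
- under eq_fun do rewrite pevalM; rewrite pevalM; exact: cvgM.
Qed.

Lemma coord_cvg (T : Type) (F : set_system T) (y : T -> 'rV[R]_m) (x : 'rV[R]_m) k :
  Filter F -> y @ F --> x -> y t 0 k @[t --> F] --> x 0 k.
Proof.
move=> FF yx; apply: (@cvg_comp _ _ _ y (fun v : 'rV[R]_m => v 0 k) F (nbhs x)) => //.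
exact: coord_continuous.
Qed.

Lemma peval_continuous (f : poly_m) : continuous (peval f : 'rV[R]_m -> R).
Proof. by move=> x; apply: (@peval_cvg _ (nbhs x) id x f) => k; exact: coord_continuous. Qed.

Lemma rV_bounded (A : set 'rV[R]_m) c : (forall x, A x -> forall k, `|x 0 k| <= c) ->
  bounded_set A.
Proof.
move=> Ac; exists (Num.max c 0); split; first exact: num_real.
move=> M cM x /Ac xc; rewrite /= /Num.Def.normr /= mx_normrE; apply/bigmax_leP; split.
  by apply/ltW/(le_lt_trans _ cM); rewrite le_max lexx orbT.
move=> [i k] _ /=; rewrite (ord1 i); apply: (le_trans (xc k)).
by apply/ltW/(le_lt_trans _ cM); rewrite le_max lexx.
Qed.

Lemma peval_closed (f : poly_m) : closed [set x : 'rV[R]_m | 0 <= peval f x].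
Proof.
apply: (@closed_comp _ _ (peval f) [set r | 0 <= r]); last exact: closed_ge.
by move=> x _; exact: peval_continuous.
Qed.

End PolynomialContinuity.

(** * Compact sets of positive semidefinite matrices *)

Section PsdCompact.
Variables (R : realType) (n : nat).
Local Notation m := (sym_dim n).
Implicit Types (x y : 'rV[R]_m).

Definition psd_box (c : R) : set 'rV[R]_m :=
  [set y | psd (symmx y) /\ forall i, y 0 (kidx i i) <= c].

(** Bounded diagonals bound all entries by [psd_entry]; for fixed [v], nonnegativity of the form is
    a closed condition. *)
Lemma psd_box_compact c : compact (psd_box c).
Proof.
apply: bounded_closed_compact.
  apply: (@rV_bounded _ _ _ c) => x [px xc] k.
  have := psd_entry (pidx k).1 (pidx k).2 px; rewrite symmx_pidx ![symmx _ _ _]mxE.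
  by have := xc (pidx k).1; have := xc (pidx k).2; lra.
pose b (v : 'rV[R]_n) : mpoly.mpoly m R :=
  \sum_i \sum_j (v 0 i * v 0 j) *: mpoly.mpolyX R (mpoly.mnm1 (kidx i j)).
pose l (i : 'I_n) : mpoly.mpoly m R :=
  mpoly.mpolyC m c - mpoly.mpolyX R (mpoly.mnm1 (kidx i i)).
have bE v x : peval (b v) x = bil (symmx x) v v.
  rewrite bilE peval_sum; apply: eq_bigr => i _; rewrite peval_sum.
  by apply: eq_bigr => j _; rewrite pevalZ pevalX mxE; ring.
have -> : psd_box c = \bigcap_v [set x | 0 <= peval (b v) x]
    `&` \bigcap_i [set x | 0 <= peval (l i) x].
  apply/seteqP; split => [x [[_ px] xc]|x [px xc]].
    by split => [v _|i _] /=; rewrite ?bE// pevalB pevalC pevalX subr_ge0.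
  split; last by move=> i; have := xc i I; rewrite /= pevalB pevalC pevalX subr_ge0.
  by split; [exact: symmx_tr | move=> v; rewrite -bE; exact: px].
by apply: closedI; apply: closed_bigI => ? _; exact: peval_closed.
Qed.

Lemma psd_box_limit (T : Type) (F : set_system T) (y : T -> 'rV[R]_m) c :
  UltraFilter F -> F [set t | psd_box c (y t)] ->
  exists2 z, psd_box c z & y @ F --> z.
Proof. by move=> FU; apply: ultra_compact_limit; exact: psd_box_compact. Qed.

End PsdCompact.

(** * Determinants under symmetric updates *)

Section DeterminantUpdate.
Variables (A : comNzRingType) (n : nat).

Lemma det_update (M : 'M[A]_n) i j h :
  \det (M + h *: delta_mx i j) = \det M + h * cofactor M i j.
Proof.
have cof k : cofactor (M + h *: delta_mx i j) i k = cofactor M i k.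
  rewrite /cofactor; congr (_ * \det _); apply/matrixP => a b; rewrite !mxE.
  by rewrite eq_sym (negPf (neq_lift _ _)) /= mulr0 addr0.
rewrite !(expand_det_row _ i) (bigD1 j) //= [X in _ = X + _](bigD1 j) //=.
rewrite cof !mxE !eqxx mulr1 mulrDl addrAC; congr (_ + _ + _).
by apply: eq_bigr => k kj; rewrite cof !mxE eqxx (negPf kj) /= mulr0 addr0.
Qed.

Lemma det_update2 (M : 'M[A]_n) i j : exists c, forall h,
  \det (M + h *: (delta_mx i j + delta_mx j i)) =
  \det M + h * (cofactor M i j + cofactor M j i) + h ^+ 2 * c.
Proof.
(* The cofactor at [(i, j)] is affine in the entry [(j, i)]; its slope is the quadratic
   coefficient. *)
exists (cofactor (M + 1 *: delta_mx j i) i j - cofactor M i j) => h.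
have cofE (N : 'M[A]_n) : cofactor N j i = \det (N + 1 *: delta_mx j i) - \det N.
  by rewrite det_update mul1r addrC addKr.
rewrite scalerDr addrA det_update !cofE addrAC !det_update; ring.
Qed.

End DeterminantUpdate.

(** * Taylor remainders and stationary points *)

Section RealLemmas.
Variables (R : realType) (n : nat).
Local Notation m := (sym_dim n).
Lemma expr_taylor (a : R) k : exists2 C : R, 0 <= C & forall h : R, `|h| <= 1 ->
  `|(a + h) ^+ k - a ^+ k - k%:R * a ^+ k.-1 * h| <= C * h ^+ 2.
Proof.
elim: k => [|k [C C0 IH]].
  by exists 0 => // h _; rewrite !expr0 subrr !mul0r subrr normr0.
(* The remainder for [k + 1] is [a + h] times the one for [k], plus [k a^(k-1) h^2]. *)
exists ((`|a| + 1) * C + `|k%:R * a ^+ k.-1|).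
  by rewrite addr_ge0// mulr_ge0// addr_ge0.
move=> h h1; rewrite [X in `|X|](_ : _ =
    (a + h) * ((a + h) ^+ k - a ^+ k - k%:R * a ^+ k.-1 * h) + k%:R * a ^+ k.-1 * h ^+ 2).
  apply: (le_trans (ler_normD _ _)); rewrite !normrM mulrDl lerD//.
    rewrite -[(_ + 1) * C * _]mulrA; apply: ler_pM => //; last exact: IH.
    by apply: (le_trans (ler_normD _ _)); rewrite lerD.
  by rewrite -[`|h| * `|h|]expr2 real_normK ?num_real.
rewrite -natr1; case: k {IH} => [|k] /=; rewrite ?expr0 ?exprS; ring.
Qed.

(** For small [h] of the sign of a nonzero [L], the linear side would exceed the quadratic one. *)
Lemma stationary_eq0 (L C e : R) : 0 < e -> (forall h : R, `|h| < e -> h * L <= C * h ^+ 2) ->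
  L = 0.
Proof.
move=> e0 hL; have C1 : 0 < `|C| + 1 by rewrite ltr_wpDl.
suff [L0 L0'] : L <= 0 /\ 0 <= L by apply/eqP; rewrite eq_le L0.
have small (s : R) : 0 < s -> exists2 h, 0 < h & `|h| < e /\ (`|C| + 1) * h < s.
  move=> s0; exists (Num.min (e / 2) (s / (2 * (`|C| + 1)))).
    by rewrite lt_min !divr_gt0// mulr_gt0.
  rewrite ger0_norm; last by rewrite le_min !divr_ge0// ?ltW// mulr_gt0.
  split; first by rewrite gt_min; apply/orP; left; lra.
  rewrite -ltr_pdivlMl// gt_min; apply/orP; right.
  by rewrite invfM mulrA [_^-1 * s]mulrC ltr_pM2r ?invr_gt0//; lra.
split; rewrite leNgt; apply/negP => L0.
  have [h h0 [he hs]] := small L L0.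
  have := hL h he; have : `|C| * h ^+ 2 < h * L.
    rewrite expr2 mulrA [_ * h]mulrC ltr_pM2l//.
    by apply: le_lt_trans hs; apply: ler_wpM2r; [exact: ltW | rewrite lerDl].
  have : C * h ^+ 2 <= `|C| * h ^+ 2 by rewrite ler_wpM2r ?sqr_ge0 ?ler_norm.
  lra.
have [|h h0 [he hs]] := small (- L); first by rewrite oppr_gt0.
have := hL (- h); rewrite normrN => /(_ he); rewrite sqrrN.
have : `|C| * h ^+ 2 < h * (- L).
  rewrite expr2 mulrA [_ * h]mulrC ltr_pM2l//.
  by apply: le_lt_trans hs; apply: ler_wpM2r; [exact: ltW | rewrite lerDl].
have : C * h ^+ 2 <= `|C| * h ^+ 2 by rewrite ler_wpM2r ?sqr_ge0 ?ler_norm.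
lra.
Qed.

Lemma symmx_delta k : (pidx k).1 != (pidx k).2 ->
  symmx (delta_mx 0 k : 'rV[R]_m) =
  delta_mx (pidx k).1 (pidx k).2 + delta_mx (pidx k).2 (pidx k).1.
Proof.
move=> k12; apply/matrixP => i j; rewrite !mxE /=.
have klt : ((pidx k).1 < (pidx k).2)%N by rewrite ltn_neqAle k12 pidx_le.
have -> : (kidx i j == k) = (pidx (kidx i j) == pidx k).
  by apply/eqP/eqP => [->//|]; apply: (can_inj (g := fun p => kidx p.1 p.2)); exact: kidxK.
rewrite pidx_kidx; case: (pidx k) klt => a b /= ab; case: leqP => ij; rewrite xpair_eqE.
  have -> : (i == b) && (j == a) = false; last by rewrite addr0.
  by apply/negP => /andP[/eqP ib /eqP ja]; move: ij; rewrite ib ja leqNgt ab.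
have -> : (i == a) && (j == b) = false; last by rewrite add0r andbC.
by apply/negP => /andP[/eqP ia /eqP jb]; move: ij; rewrite ia jb ltnNge ltnW.
Qed.

End RealLemmas.

(** * Maximum determinant completions *)

Section Dempster.
Variables (R : realType) (n : nat) (S Z : pred 'I_(sym_dim n)).
Local Notation m := (sym_dim n).
Hypothesis Sdiag : forall i, ~~ S (kidx i i).
Hypothesis SZ : forall k, Z k -> ~~ S k.
Implicit Types (x y z : 'rV[R]_m).

Local Notation adj_at y k := (\adj (symmx y) (pidx k).1 (pidx k).2).

Lemma S_offdiag k : S k -> (pidx k).1 != (pidx k).2.
Proof.
by move=> Sk; apply: contraTneq Sk => e; rewrite -[k]kidxK e; exact: Sdiag.
Qed.

Definition psd_fibre x0 : set 'rV[R]_m :=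
  [set y | psd (symmx y) /\ forall k, ~~ S k -> y 0 k = x0 0 k].

Lemma psd_fibre_box x0 : psd_fibre x0 `<=` psd_box (\sum_i `|x0 0 (kidx i i)|).
Proof.
move=> y [py yx]; split=> // i; rewrite yx ?Sdiag//.
by rewrite (bigD1 i) //= ler_wpDr ?sumr_ge0// ler_norm.
Qed.

Lemma psd_fibre_compact x0 : compact (psd_fibre x0).
Proof.
apply: subclosed_compact (@psd_box_compact _ _ _) (@psd_fibre_box x0).
have -> : psd_fibre x0 = psd_box (\sum_i `|x0 0 (kidx i i)|) `&`
    \bigcap_(k in [set k | ~~ S k]) [set y | y 0 k = x0 0 k].
  apply/seteqP; split => [y yx|y [[py _] yx]]; last by split.
  by split; [exact: psd_fibre_box | case: yx].
apply: closedI.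
  apply: compact_closed; last exact: psd_box_compact.
  exact: norm_hausdorff.
apply: closed_bigI => k _.
apply: (@closed_comp _ _ (fun y : 'rV[R]_m => y 0 k) [set a | a = x0 0 k]).
  by move=> y _; exact: coord_continuous.
exact: closed_eq.
Qed.

(* A maximizer of [det - eps * sum_(k in S) y_k ^ (2N + 2)] over the fibre.  For
   [eps = 0] this is Dempster's maximum determinant completion; positive [eps] gives
   a system of equations with triangular leading terms. *)
Lemma perturbed_critical N (eps : R) x0 : 0 <= eps -> posdef (symmx x0) ->
  exists y, [/\ psd (symmx y), forall k, ~~ S k -> y 0 k = x0 0 k,
    \det (symmx x0) - eps * \sum_(k | S k) x0 0 k ^+ N.*2.+2 <= \det (symmx y) &
    0 < \det (symmx y) -> forall k, S k ->
      2 * adj_at y k = eps * N.*2.+2%:R * y 0 k ^+ N.*2.+1].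
Proof.
move=> eps0 px0.
pose F y := \det (symmx y) - eps * \sum_(k | S k) y 0 k ^+ N.*2.+2.
have Fcont : continuous F.
  have -> : F = peval (\det (symvar R n) -
      eps *: \sum_(k | S k) mpoly.mpolyX R (mpoly.mnm1 k) ^+ N.*2.+2) :> (_ -> _).
    apply/funext => y; rewrite pevalB pevalZ peval_det peval_sum /F; congr (_ - _ * _).
    by apply: eq_bigr => k _; rewrite /peval rmorphXn /= -/(peval _ _) pevalX.
  exact: peval_continuous.
have [|y /set_mem[py yx] ymax] := compact_EVT_max _ (@psd_fibre_compact x0)
    (continuous_subspaceT Fcont).
  by exists x0; split => //; exact: posdef_psd.
have {}ymax z : psd_fibre x0 z -> F z <= F y by move=> h; apply: ymax; exact: mem_set.
exists y; split => //.
  (* Compare with [x0] and drop the penalty at [y], which is nonnegative because its exponent is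
     even. *)
  have := ymax x0 (conj (posdef_psd px0) (fun _ _ => erefl)); rewrite /F.
  move/le_trans; apply; rewrite gerBl mulr_ge0// sumr_ge0// => k _.
  by rewrite -doubleS -mul2n exprM exprn_ge0 ?sqr_ge0.
move=> dy k Sk; have kd := S_offdiag Sk.
(* A positive definite [y] can be moved along coordinate [k] in both directions within the fibre. *)
have pdy : posdef (symmx y) by apply: psd_posdef => //; rewrite gt_eqF.
set D : 'rV[R]_m := delta_mx 0 k.
have [e e0 pe] := posdef_line pdy (symmx_tr D).
have [c cE] := det_update2 (symmx y) (pidx k).1 (pidx k).2.
have [C C0 CE] := expr_taylor (y 0 k) N.*2.+2.
pose L := 2 * adj_at y k - eps * N.*2.+2%:R * y 0 k ^+ N.*2.+1.
suff : L = 0 by move/eqP; rewrite subr_eq0 => /eqP.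
(* [L] is the first-order coefficient; the constant collects the quadratic term of the determinant
   and the Taylor remainder of the penalty. *)
apply: (@stationary_eq0 R L (`|c| + eps * C) (Num.min e 1)).
  by rewrite lt_min e0 ltr01.
move=> h; rewrite lt_min => /andP[he /ltW h1].
have hS : symmx (y + h *: D) = symmx y + h *: symmx D by rewrite symmxD symmxZ.
have : F (y + h *: D) <= F y.
  apply: ymax; split; first by rewrite hS; apply/posdef_psd/pe.
  move=> l Sl; rewrite !mxE /=; have [lk|_] := eqVneq l k; last by rewrite mulr0 addr0 yx.
  by rewrite lk Sk in Sl.
rewrite /F hS symmx_delta// cE (bigD1 k) //= [X in _ <= _ - eps * X](bigD1 k) //=.
rewrite (eq_bigr (fun l => y 0 l ^+ N.*2.+2)); last first.
  by move=> l /andP[_ lk]; rewrite !mxE /= (negPf lk) mulr0 addr0.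
have -> : cofactor (symmx y) (pidx k).1 (pidx k).2 + cofactor (symmx y) (pidx k).2 (pidx k).1
    = 2 * adj_at y k.
  have -> : cofactor (symmx y) (pidx k).1 (pidx k).2 = (\adj (symmx y))^T (pidx k).1 (pidx k).2.
    by rewrite !mxE.
  rewrite adj_tr ?symmx_tr// mulr_natl mulr2n; congr (_ + _).
  by rewrite mxE.
have -> : (y + h *: D) 0 k = y 0 k + h by rewrite !mxE !eqxx mulr1.
have := CE h h1; rewrite ler_norml => /andP[_]; rewrite /L /=.
have := ler_norm (- c); rewrite normrN; have := sqr_ge0 h.
set s := \sum_(_ < _ | _) _; set a : R := adj_at y k; set b := y 0 k ^+ _; set b' := y 0 k ^+ _.
set b'' := (y 0 k + h) ^+ _; set q := N.*2.+2%:R.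
move=> h2 hc hC hF.
have hC' : eps * (b'' - b - q * b' * h) <= eps * (C * h ^+ 2) by rewrite ler_wpM2l.
have hc' : - c * h ^+ 2 <= `|c| * h ^+ 2 by rewrite ler_wpM2r.
lra.
Qed.

(** The maximum of the determinant over the fibre is at least its positive value at [x0], so the
    maximizer is positive definite and stationary. *)
Lemma dempster x0 : posdef (symmx x0) -> (forall k, Z k -> x0 0 k = 0) ->
  exists y, [/\ dmset S Z y, forall k, ~~ S k -> y 0 k = x0 0 k &
    \det (symmx x0) <= \det (symmx y)].
Proof.
move=> px0 Zx0.
have [y [py yx dy /=]] := @perturbed_critical 0 0 x0 (lexx _) px0.
move: dy; rewrite mul0r subr0 => dy; have d0 := posdef_det_gt0 px0.
move=> /(_ (lt_le_trans d0 dy)) crit; exists y; split => //; split.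
- by apply: psd_posdef => //; rewrite gt_eqF// (lt_le_trans d0).
- move=> k Sk; have := crit k Sk; rewrite !mul0r => /eqP.
  by rewrite mulf_eq0 pnatr_eq0 => /eqP.
- by move=> k Zk; rewrite yx ?SZ// Zx0.
Qed.

(** Compactness provides a limit; the bound on the determinant keeps it positive definite, the
    limits of the equations put it into the model, and [dmset_unique] identifies it with [x]. *)
Lemma dmset_limit (T : Type) (F : set_system T) (y : T -> 'rV[R]_m) x (c e : R) :
  UltraFilter F -> 0 < e -> dmset S Z x ->
  F [set t | psd_box c (y t) /\ e <= \det (symmx (y t))] ->
  (forall k, S k -> adj_at (y t) k @[t --> F] --> (0 : R)) ->
  (forall k, ~~ S k -> y t 0 k @[t --> F] --> (x 0 k : R)) ->
  y @ F --> x.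
Proof.
move=> FU e0 dx Fy yS yx.
have FF : Filter F by exact: filter_filter.
have [|z [pz _] yz] := @psd_box_limit R n T F y c FU.
  by apply: filterS Fy => t [].
have pc f : peval f (y t) @[t --> F] --> peval f z.
  by apply: peval_cvg => k; exact: coord_cvg.
suff <- : z = x by [].
have uniq (f : T -> R) (a b : R) : f @ F --> a -> f @ F --> b -> a = b.
  move=> fa fb; have P : ProperFilter (f @ F) by exact: fmap_proper_filter.
  exact: (@cvg_unique _ (@Rhausdorff R) _ P a b fa fb).
have zx k : ~~ S k -> z 0 k = x 0 k.
  move=> Sk; apply: uniq (yx k Sk); have := pc (mpoly.mpolyX R (mpoly.mnm1 k)).
  by under eq_fun do rewrite pevalX; rewrite pevalX.
have dz : e <= \det (symmx z).
  rewrite -peval_det; apply: (@closed_cvg _ _ F _ (fun t => peval (\det (symvar R n)) (y t))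
     (fun r : R => e <= r)); [exact: closed_ge | | exact: pc].
  by apply: filterS Fy => t [_]; rewrite peval_det.
apply: (dmset_unique (Z := Z) Sdiag) => //; split.
- by apply: psd_posdef => //; rewrite gt_eqF// (lt_le_trans e0).
- move=> k Sk; apply/esym; apply: uniq (yS k Sk) _.
  have := pc (\adj (symvar R n) (pidx k).1 (pidx k).2).
  by under eq_fun do rewrite peval_adj; rewrite peval_adj.
- by move=> k Zk; rewrite zx ?SZ//; case: dx => _ _; apply.
Qed.

End Dempster.

(** * Lifting segments of parameters *)

Section Gronwall.
Variable R : realType.

(** The sum of squares [w] satisfies [w' <= K w], so [w] times [exp (- K t)] cannot increase from
    its value 0. *)
Lemma gronwall (r : nat) (u : 'I_r -> R -> R) (b : 'I_r -> 'I_r -> R -> R) (s e B : R) :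
  (forall i t, s < t < e -> is_derive t (1 : R) (u i) (\sum_j b i j t * u j t)) ->
  (forall i, continuous (u i)) ->
  (forall i j t, s < t < e -> `|b i j t| <= B) ->
  (forall i, u i s = 0) ->
  forall i t, s <= t <= e -> u i t = 0.
Proof.
move=> du cu bB us i t /andP[st te].
pose K := 2 * B * r%:R.
pose w : R -> R := \sum_i u i ^+ 2.
have wE x : w x = \sum_i u i x ^+ 2 by rewrite /w fct_sumE.
pose E : R -> R := expR \o (fun x => - (K * x)).
have dw x : s < x < e -> is_derive x (1 : R) w (\sum_i 2 * u i x * (\sum_j b i j x * u j x)).
  move=> sx; apply: is_derive_sum => l; apply: is_derive_eq; first exact/is_deriveX/du.
  by rewrite expr1.
have dE x : is_derive x (1 : R) E (- K * expR (- (K * x))).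
  have dl : is_derive x (1 : R) (- (K \*: id) : R -> R) (- K).
    by apply: is_derive_eq; rewrite [_ *: _]mulr1.
  by rewrite mulrC; exact: (is_derive1_comp (is_derive_expR _) dl).
have dEw x : s < x < e -> is_derive x (1 : R) (E * w)
    (E x *: (\sum_i 2 * u i x * (\sum_j b i j x * u j x)) + w x *: (- K * expR (- (K * x)))).
  by move=> sx; apply: is_deriveM; exact: dw.
have Ec : continuous E.
  by move=> x; apply: differentiable_continuous; rewrite -derivable1_diffP; case: (dE x).
have wc : continuous w.
  have -> : w = fun x => \sum_i u i x ^+ 2 by apply/funext.
  apply: continuous_big => [|l _]; first exact: add_continuous.
  have -> : (fun x => u l x ^+ 2) = u l * u l by apply/funext => x; rewrite expr2.
  by move=> x; apply: continuousM; exact: cu.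
have Ew : (E * w) t <= (E * w) s.
  apply: (@ler0_derive1_nincr R (E * w) s e _ _ _ s t (lexx s) st te).
  - by move=> x; rewrite in_itv => sx; case: (dEw x sx).
  - move=> x; rewrite in_itv => sx; rewrite derive1E; case: (dEw x sx) => _ ->.
    set X := \sum_i _; rewrite -[X in X <= _]/(E x * X + w x * (- K * E x)).
    have -> (p q y z : R) : p * q + y * (- z * p) = p * (q - z * y) by ring.
    apply: mulr_ge0_le0; first exact: expR_ge0.
    rewrite wE subr_le0 /K.
    have -> : 2 * B * r%:R * (\sum_i u i x ^+ 2) =
        \sum_i \sum_(j < r) B * (u i x ^+ 2 + u j x ^+ 2).
      under [RHS]eq_bigr do rewrite -mulr_sumr big_split /= sumr_const card_ord.
      rewrite -mulr_sumr big_split /= sumr_const card_ord sumrMnl.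
      by rewrite -[_ *+ r]mulr_natr; ring.
    apply: ler_sum => l _; rewrite big_distrr; apply: ler_sum => k _ /=.
    have := bB l k x sx; rewrite ler_norml => /andP[b1 b2].
    (* These two inequalities add up to [4 b u_l u_k <= 2 B (u_l^2 + u_k^2)]. *)
    have h1 : 0 <= (B - b l k x) * (u l x + u k x) ^+ 2 by rewrite mulr_ge0 ?sqr_ge0// subr_ge0.
    have h2 : 0 <= (B + b l k x) * (u l x - u k x) ^+ 2 by rewrite mulr_ge0 ?sqr_ge0//; lra.
    lra.
  - by apply: continuous_subspaceT => x; apply: continuousM; [exact: Ec | exact: wc].
have w0 : w t <= 0.
  have ws : w s = 0 by rewrite wE big1// => l _; rewrite us expr0n.
  have {}Ew : E t * w t <= 0 by rewrite (le_trans Ew)// [X in X <= _](_ : _ = E s * w s)// ws mulr0.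
  have Et : 0 < E t by exact: expR_gt0.
  by rewrite leNgt; apply/negP => wt; move: Ew; rewrite leNgt mulr_gt0.
have /psumr_eq0P h : forall l, true -> 0 <= u l t ^+ 2 by move=> l _; exact: sqr_ge0.
apply/eqP; rewrite -sqrf_eq0; apply/eqP; apply: h => //.
by apply/eqP; rewrite -wE eq_le w0 wE sumr_ge0// => l _; exact: sqr_ge0.
Qed.

End Gronwall.

(** * Differentiable lifts of parameter segments *)

Section Curves.
Variables (R : realType) (n : nat) (S Z : pred 'I_(sym_dim n)).
Local Notation m := (sym_dim n).
Local Notation poly_m := (mpoly.mpoly m R).
Hypothesis Sdiag : forall i, ~~ S (kidx i i).
Hypothesis SZ : forall k, Z k -> ~~ S k.
Implicit Types (x y z : 'rV[R]_m) (f : poly_m).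

(** Freezing the parameter outside [0, 1] yields curves that are continuous on the whole line. *)
Definition clamp (t : R) : R := Num.max 0 (Num.min t 1).

Lemma clamp_itv t : 0 <= clamp t <= 1.
Proof. by rewrite /clamp le_max lexx ge_max ler01 ge_min lexx orbT. Qed.

Lemma clampE t : 0 <= t <= 1 -> clamp t = t.
Proof. by move=> /andP[t0 t1]; rewrite /clamp min_l// max_r. Qed.

Lemma clamp_continuous : continuous clamp.
Proof.
move=> t; rewrite /clamp.
apply: (@continuous_max R R (fun=> 0) (fun t => Num.min t 1)); first exact: cvg_cst.
by apply: (@continuous_min R R id (fun=> 1)); [exact: cvg_id | exact: cvg_cst].
Qed.

Definition segm x0 x1 (t : R) : 'rV[R]_m := (1 - t) *: x0 + t *: x1.

Definition free_part (v : 'rV[R]_m) : 'cV[R]_m := \col_k if S k then 0 else v 0 k.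

(** The parameters move with [v], and the adjugate equations stay satisfied to first order. *)
Definition velocity (v p : 'rV[R]_m) : 'cV[R]_m :=
  invmx (jac_mx S p p) *m free_part v.

Definition lifts x0 x1 (g : R -> 'rV[R]_m) : Prop :=
  [/\ forall t : R, dmset S Z (g t),
      forall (t : R) k, 0 <= t <= 1 -> ~~ S k -> g t 0 k = segm x0 x1 t 0 k,
      forall k, continuous (fun t => g t 0 k) &
      forall (t : R) k, 0 < t < 1 ->
        is_derive t (1 : R) (fun t => g t 0 k) (velocity (x1 - x0) (g t) k 0)].

(** By the exact difference quotient, [g (t + h) - g t] is [h] times the inverse of a continuous
    matrix applied to the parameter direction; so continuity of [g] already gives the derivative. *)
Lemma curve_derivative x0 x1 (g : R -> 'rV[R]_m) (t : R) k :
  (forall t : R, 0 <= t <= 1 -> dmset S Z (g t)) ->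
  (forall (t : R) k, 0 <= t <= 1 -> ~~ S k -> g t 0 k = segm x0 x1 t 0 k) ->
  (forall k, continuous (fun t => g t 0 k)) -> 0 < t < 1 ->
  is_derive t (1 : R) (fun t => g t 0 k) (velocity (x1 - x0) (g t) k 0).
Proof.
move=> gX gx gc /andP[t0 t1].
have tt : 0 <= t <= 1 by rewrite !ltW.
(* With the second argument frozen at [g t], Cramer's rule makes the quotient a ratio of polynomials
   in the first. *)
pose J := jac_mx S (varrow R n) (map_mx (mpoly.mpolyC m (R:=R)) (g t)).
pose v := free_part (x1 - x0).
have JE (p : 'rV[R]_m) : map_mx (mpoly.meval (p 0)) J = jac_mx S p (g t).
  rewrite map_jac_mx peval_varrow; congr jac_mx; apply/rowP => l.
  by rewrite !mxE; exact: mpoly.mevalC.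
pose num : poly_m := \sum_j \adj J k j * mpoly.mpolyC m (v j 0).
have numE (p : 'rV[R]_m) : posdef (symmx p) ->
    (invmx (jac_mx S p (g t)) *m v) k 0 = peval num p / peval (\det J) p.
  move=> pp; have Ju := jac_mx_unit Sdiag pp (let: And3 h _ _ := gX t tt in h).
  rewrite /invmx Ju -scalemxAl mxE mulrC; congr (_ / _).
    rewrite /num mxE peval_sum; apply: eq_bigr => j _.
    by rewrite pevalM pevalC -JE -map_mx_adj [in LHS]mxE.
  by rewrite -JE det_map_mx.
have [pt _ _] := gX t tt.
have dJ0 : peval (\det J) (g t) != 0.
  have := jac_mx_unit Sdiag pt pt.
  by rewrite unitmxE unitfE -JE det_map_mx.
have -> : velocity (x1 - x0) (g t) k 0 = peval num (g t) / peval (\det J) (g t).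
  by rewrite -numE.
have qcvg : (fun h : R => h^-1 *: (((fun t => g t 0 k) \o shift t) (h *: (1 : R)) - g t 0 k))
    @ 0^' --> (peval num (g t) / peval (\det J) (g t) : R).
  have sc : (fun h : R => h *: (1 : R) + t) @ 0^' --> t.
    rewrite -[X in _ --> X]add0r; apply: cvgD; last exact: cvg_cst.
    rewrite -[X in _ --> X](scale0r (1 : R)); apply: cvgZl; exact: cvg_within.
  have gcv f : peval f (g (h *: (1 : R) + t)) @[h --> 0^'] --> peval f (g t).
    by apply: peval_cvg => l; 
    exact: (@cvg_comp _ _ _ (fun h : R => h *: (1 : R) + t) (fun s => g s 0 l) (0^')
       (nbhs t) (nbhs (g t 0 l)) sc (gc l t)).
  have : (fun h : R => peval num (g (h *: (1 : R) + t)) / peval (\det J) (g (h *: (1 : R) + t)))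
      @ 0^' --> (peval num (g t) / peval (\det J) (g t) : R).
    by apply: cvgM => //; apply: cvgV.
  apply: cvg_trans; apply: near_eq_cvg.
  (* The parameters follow the segment only on [0, 1], so [t + h] has to stay there. *)
  have t1t : 0 < Num.min t (1 - t) by rewrite lt_min t0 subr_gt0.
  near=> h; have h0 : h != 0 by near: h; exact: nbhs_dnbhs_neq.
  have ht : `|h| < Num.min t (1 - t).
    by near: h; apply: dnbhs0_lt.
  have /andP[h1 h2] : 0 <= h *: (1 : R) + t <= 1.
    move: ht; rewrite lt_min ltr_norml => /andP[/andP[? ?]]; rewrite ltr_norml => /andP[? ?].
    by rewrite [_ *: _]mulr1; apply/andP; split; lra.
  have hh : 0 <= h *: (1 : R) + t <= 1 by rewrite h1.
  have [ph ah _] := gX _ hh; have [_ at_ _] := gX t tt.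
  rewrite -numE //= -[RHS]/(h^-1 * (g _ 0 k - g t 0 k)).
  have := jac_mx_diff ah at_; rewrite /free_part.
  have Ju := jac_mx_unit Sdiag ph pt.
  move=> /(congr1 (mulmx (invmx (jac_mx S (g (h *: (1 : R) + t)) (g t))))).
  rewrite mulKmx// => /(congr1 (fun w : 'cV_m => w k 0)).
  have -> : (\col_k0 (if S k0 then 0 else (g (h *: (1 : R) + t) - g t) 0 k0)) = h *: v.
    apply/colP => l; rewrite !mxE; case: ifPn => Sl; first by rewrite mulr0.
    by rewrite !gx// /segm !mxE [_ *: 1]mulr1; ring.
  rewrite -scalemxAr [RHS]mxE => e; rewrite [_ - _](_ : _ = (g (h *: (1 : R) + t) - g t)^T k 0).
    by rewrite e mulrA mulVf// mul1r.
  by rewrite !mxE.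
apply: DeriveDef; first by apply/cvg_ex; eexists; exact: qcvg.
exact: (cvg_lim (@Rhausdorff R) qcvg).
Unshelve. all: by end_near.
Qed.

(** Complete every point of the segment by [dempster]; uniqueness makes the completions continuous,
    hence differentiable. *)
Lemma lift_exists x0 x1 : posdef (symmx x0) -> posdef (symmx x1) ->
  (forall k, Z k -> x0 0 k = 0) -> (forall k, Z k -> x1 0 k = 0) ->
  exists g, lifts x0 x1 g.
Proof.
move=> p0 p1 z0 z1.
pose z t := segm x0 x1 (clamp t).
have pz t : posdef (symmx (z t)).
  by rewrite /z /segm symmxD !symmxZ; apply: posdef_convex => //; exact: clamp_itv.
have zZ t k : Z k -> z t 0 k = 0 by move=> Zk; rewrite !mxE z0// z1// !mulr0 addr0.
have /choice[g gP] : forall t, exists y, [/\ dmset S Z y, forall k, ~~ S k -> y 0 k = z t 0 k &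
    \det (symmx (z t)) <= \det (symmx y)].
  by move=> t; apply: dempster => //; exact: zZ.
have zc k : continuous (fun t => z t 0 k).
  move=> t; rewrite /z /segm.
  have -> : (fun t => ((1 - clamp t) *: x0 + clamp t *: x1) 0 k) =
      (fun t => (1 - clamp t) * x0 0 k + clamp t * x1 0 k) by apply/funext => s; rewrite !mxE.
  apply: cvgD; apply: cvgM; try exact: cvg_cst; last exact: clamp_continuous.
  by apply: cvgB; [exact: cvg_cst | exact: clamp_continuous].
have gc t : g @ t --> g t.
  apply: cvg_ultra => G GU tG.
  have [dt gt _] := gP t.
  pose c := \sum_i (`|x0 0 (kidx i i)| + `|x1 0 (kidx i i)|).
  have d0 := posdef_det_gt0 (pz t).
  (* Completion does not decrease the determinant, so near [t] it is at least half that of [z t];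
     [c] bounds the diagonals along the segment. *)
  apply: (@dmset_limit R n S Z Sdiag SZ _ G g (g t) c (\det (symmx (z t)) / 2)) => //.
  - by rewrite divr_gt0.
  - apply: filterS (tG [set s | \det (symmx (z t)) / 2 <= \det (symmx (z s))] _).
      move=> s /= hs; have [[ps as_ zs] gs ds] := gP s; split; last exact: le_trans ds.
      split; first exact: posdef_psd.
      move=> i; rewrite gs ?Sdiag// /z /segm !mxE /c (bigD1 i) //=.
      have /andP[c0 c1] := clamp_itv s; set r := clamp s in c0 c1 *.
      rewrite -[leLHS]addr0; apply: lerD; last by apply: sumr_ge0 => j _; rewrite addr_ge0.
      have := ler_norm (x0 0 (kidx i i)); have := ler_norm (x1 0 (kidx i i)).
      have := normr_ge0 (x0 0 (kidx i i)); have := normr_ge0 (x1 0 (kidx i i)).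
      set a := x0 _ _; set b := x1 _ _ => b0 a0 hb ha.
      have : (1 - r) * a <= (1 - r) * `|a| by rewrite ler_wpM2l// subr_ge0.
      have : r * b <= r * `|b| by rewrite ler_wpM2l.
      have : 0 <= (1 - r) * `|b| by rewrite mulr_ge0// subr_ge0.
      have : 0 <= r * `|a| by rewrite mulr_ge0.
      by lra.
    have dc : \det (symmx (z s)) @[s --> t] --> (\det (symmx (z t)) : R).
      rewrite -peval_det; under eq_fun do rewrite -peval_det.
      by apply: peval_cvg => k; exact: zc.
    have : \forall s \near t, \det (symmx (z t)) / 2 < \det (symmx (z s)).
      by apply: (cvgr_gt _ dc); rewrite ltr_pdivrMr// mulr_natr mulr2n ltrDl.
    by apply: filterS => s /ltW.
  - move=> k Sk; rewrite (_ : (fun s => _) = fun=> 0); first exact: cvg_cst.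
    by apply/funext => s; have [[_ h _] _ _] := gP s; exact: h.
  - move=> k Sk; rewrite gt//; under eq_fun => s.
      have [_ h _] := gP s; rewrite (h k Sk); over.
    by move=> A /zc /tG.
have gX t : dmset S Z (g t) by case: (gP t).
have gx t k : 0 <= t <= 1 -> ~~ S k -> g t 0 k = segm x0 x1 t 0 k.
  by move=> tt Sk; have [_ h _] := gP t; rewrite h// /z clampE.
have gck k : continuous (fun t => g t 0 k).
  by move=> t; apply: coord_cvg; exact: gc.
by exists g; split => // t k; apply: curve_derivative.
Qed.

End Curves.

(** * Primality *)

Section Primality.
Variables (R : realType) (n : nat) (S Z : pred 'I_(sym_dim n)).
Local Notation m := (sym_dim n).
Local Notation poly_m := (mpoly.mpoly m R).
Hypothesis Sdiag : forall i, ~~ S (kidx i i).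
Hypothesis SZ : forall k, Z k -> ~~ S k.
Implicit Types (x y z p : 'rV[R]_m) (f h : poly_m).

Lemma peval_is_derive (g : R -> 'rV[R]_m) (t : R) (u : 'I_m -> R) f :
  (forall k, is_derive t (1 : R) (fun s => g s 0 k) (u k)) ->
  is_derive t (1 : R) (fun s => peval f (g s))
    (\sum_k u k * peval (mpoly.mderiv k f) (g t)).
Proof.
move=> du; elim/mpoly_ring_ind: f => [c|k|f1 f2 h1 h2|f1 f2 h1 h2].
- rewrite [X in is_derive _ _ X _](_ : _ = cst c); last first.
    by apply/funext => s; rewrite pevalC.
  apply: is_derive_eq; rewrite big1 // => k _.
  by rewrite mpoly.mderivC peval0 mulr0.
- rewrite [X in is_derive _ _ X _](_ : _ = fun s => g s 0 k); last first.
    by apply/funext => s; rewrite pevalX.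
  apply: (is_derive_eq (du k)); rewrite (bigD1 k) //= big1 => [|j jk].
    by rewrite addr0 mderiv_var eqxx peval1 mulr1.
  by rewrite mderiv_var eq_sym (negPf jk) peval0 mulr0.
- rewrite [X in is_derive _ _ X _](_ : _ =
      (fun s => peval f1 (g s)) + (fun s => peval f2 (g s))); last first.
    by apply/funext => s; rewrite pevalD.
  apply: is_derive_eq; rewrite -big_split; apply: eq_bigr => k _ /=.
  by rewrite mpoly.mderivD pevalD mulrDr.
- rewrite [X in is_derive _ _ X _](_ : _ =
      (fun s => peval f1 (g s)) * (fun s => peval f2 (g s))); last first.
    by apply/funext => s; rewrite pevalM.
  apply: is_derive_eq; rewrite -![_ *: _]/(_ * _) !big_distrr -big_split.
  apply: eq_bigr => k _ /=.
  by rewrite mpoly.mderivM pevalD !pevalM; ring.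
Qed.

Definition jac_det : poly_m := \det (jac_mx S (varrow R n) (varrow R n)).

(* Along a lift of a segment of direction [v], the derivative of [f] is
   [vfield v f / jac_det]: the denominator is cleared to stay among polynomials. *)
Definition vfield (v : 'rV[R]_m) f : poly_m :=
  \sum_k (\sum_j \adj (jac_mx S (varrow R n) (varrow R n)) k j
                 * mpoly.mpolyC m (free_part S v j 0)) * mpoly.mderiv k f.

Lemma peval_jac_det p : peval jac_det p = \det (jac_mx S p p).
Proof. by rewrite -peval_jac det_map_mx. Qed.

Lemma peval_vfield v f p : posdef (symmx p) ->
  peval (vfield v f) p =
  peval jac_det p * \sum_k velocity S v p k 0 * peval (mpoly.mderiv k f) p.
Proof.
move=> pp; have Ju := jac_mx_unit Sdiag pp pp.
rewrite peval_sum big_distrr; apply: eq_bigr => k _ /=.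
rewrite pevalM mulrA; congr (_ * _).
rewrite peval_jac_det /velocity /invmx Ju -scalemxAl [X in _ * X]mxE mulrA divff; last first.
  by rewrite -unitfE -unitmxE.
rewrite mul1r mxE peval_sum; apply: eq_bigr => j _.
by rewrite pevalM pevalC -peval_jac -map_mx_adj [in RHS]mxE.
Qed.

Lemma jac_det_neq0 p : dmset S Z p -> peval jac_det p != 0.
Proof.
move=> [pp _ _]; have := jac_mx_unit Sdiag pp pp.
by rewrite unitmxE unitfE -peval_jac_det.
Qed.

Section Lift.
Variables (x0 x1 : 'rV[R]_m) (g : R -> 'rV[R]_m).
Hypothesis gL : lifts S Z x0 x1 g.

Lemma lift_continuous f : continuous (fun t => peval f (g t)).
Proof. by move=> t; have [_ _ gc _] := gL; apply: peval_cvg => k; exact: gc. Qed.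

Lemma lift_is_derive f (t : R) : 0 < t < 1 ->
  is_derive t (1 : R) (fun t => peval f (g t))
    (peval (vfield (x1 - x0) f) (g t) / peval jac_det (g t)).
Proof.
move=> tt; have [gX _ _ gd] := gL.
have [gp _ _] := gX t; rewrite peval_vfield// mulrC mulrA mulVf ?mul1r.
  by apply: peval_is_derive => k; exact: gd.
exact: jac_det_neq0 (gX t).
Qed.

(** The derivative of a function vanishing on an open interval vanishes there, and is the next
    iterate divided by [jac_det]. *)
Lemma lift_vanish_iter f (s : R) : s <= 1 -> (forall t : R, 0 <= t < s -> peval f (g t) = 0) ->
  forall k (t : R), 0 < t < s -> peval (iter k (vfield (x1 - x0)) f) (g t) = 0.
Proof.
move=> s1 f0; elim => [|k IH] t /andP[t0 ts]; first by apply: f0; rewrite ltW.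
have [gX _ _ _] := gL.
have t1 : 0 < t < 1 by rewrite t0 (lt_le_trans ts).
have /near_eq_is_derive : \forall u \near t,
    peval (iter k (vfield (x1 - x0)) f) (g u) = (cst 0 : R -> R) u.
  near=> u; apply: IH; apply/andP; split.
    by near: u; exact: lt_nbhsr.
  by near: u; exact: lt_nbhsl.
move=> /(_ 1 _ (lift_is_derive _ t1)) [_].
rewrite derive_cst => /esym/eqP; rewrite mulf_eq0 invr_eq0 (negPf (jac_det_neq0 (gX t))) orbF.
by move/eqP.
Unshelve. all: by end_near.
Qed.

Lemma bounded_on_lift f : exists B : R, forall t : R, 0 < t < 1 ->
  `|peval f (g t) / peval jac_det (g t)| <= B.
Proof.
have [gX _ _ _] := gL.
have qc : continuous (fun t => `|peval f (g t) / peval jac_det (g t)|).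
  move=> t; apply: cvg_norm; apply: cvgM; first exact: lift_continuous.
  by apply: cvgV; [exact: jac_det_neq0 (gX t) | exact: lift_continuous].
have [c _ cmax] := EVT_max (@ler01 R) (continuous_subspaceT qc).
exists (`|peval f (g c) / peval jac_det (g c)|) => t /andP[t0 t1].
by apply: cmax; rewrite in_itv /= !ltW.
Qed.

(* The iterated derivatives of [f] generate a finitely generated ideal, so finitely
   many of them satisfy a homogeneous linear system of differential equations. *)
Theorem lift_identity f (s : R) : 0 < s <= 1 ->
  (forall t : R, 0 <= t < s -> peval f (g t) = 0) ->
  forall t : R, 0 <= t <= 1 -> peval f (g t) = 0.
Proof.
move=> /andP[s0 s1] f0.
pose G k := iter k (vfield (x1 - x0)) f.
have G0 := lift_vanish_iter s1 f0.
have [r] := ideal_chain_stabilizes G.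
(* For [r = 0] the relation says [f = 0]. *)
case: r => [|r]; first by move=> /= f00 t _; rewrite [f]f00 peval0.
move: r.+1 (ltn0Sn r) => {}r r0.
rewrite ideal_spanE => -[h hE].
have {h hE}[a aE] : exists a : 'I_r -> 'I_r -> poly_m,
    forall i : 'I_r, G i.+1 = \sum_j a i j * G j.
  have sz : size (mkseq G r) = r by rewrite size_mkseq.
  (* A companion matrix: each row shifts to the next iterate, and the last one is the relation
     [h]. *)
  exists (fun i j => if i.+1 == r then h (cast_ord (esym sz) j)
                     else (i.+1 == j :> nat)%:R).
  move=> i; have [ir|ir] := eqVneq i.+1 r.
    rewrite ir hE (reindex (cast_ord (esym sz))) /=; last first.
      by exists (cast_ord sz) => j _; [exact: cast_ordKV | exact: cast_ordK].
    by apply: eq_bigr => j _; rewrite nth_mkseq.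
  have ir' : (i.+1 < r)%N by rewrite ltn_neqAle ir ltn_ord.
  rewrite (bigD1 (Ordinal ir')) //= eqxx mul1r big1 ?addr0// => j ji.
  rewrite (_ : (i.+1 == j) = false) ?mul0r//; apply: contraNF ji => /eqP e.
  by apply/eqP/val_inj; rewrite /= e.
have [gX _ _ _] := gL.
have f1 (t : R) : s / 2 <= t <= 1 -> peval f (g t) = 0.
  move=> tt; case: r r0 a aE => [//|r] _ a aE.
  pose u (i : 'I_r.+1) t := peval (G i) (g t).
  pose b (i j : 'I_r.+1) t := peval (a i j) (g t) / peval jac_det (g t).
  have /choice[B BP] : forall ij : 'I_r.+1 * 'I_r.+1, exists B : R, forall t : R, 0 < t < 1 ->
      `|b ij.1 ij.2 t| <= B by move=> ij; exact: bounded_on_lift.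
  have in01 (x : R) : s / 2 < x < 1 -> 0 < x < 1.
    by move=> /andP[sx ->]; rewrite (lt_trans _ sx)// divr_gt0.
  (* At [s / 2], inside the interval where [f] vanishes, all iterates vanish. *)
  apply: (@gronwall R r.+1 u b (s / 2) 1 (\sum_ij `|B ij|) _ _ _ _ ord0 t tt).
  - move=> i x /in01 x01; apply: (is_derive_eq (lift_is_derive _ x01)).
    rewrite -[vfield _ _]/(G i.+1) aE peval_sum big_distrl; apply: eq_bigr => j _ /=.
    by rewrite pevalM /b /u mulrAC.
  - by move=> i; exact: lift_continuous.
  - move=> i j x /in01 x01; apply: (le_trans (BP (i, j) x x01)).
    by apply: (le_trans (ler_norm _)); rewrite (bigD1 (i, j)) //= lerDl sumr_ge0.
  - by move=> i; apply: G0; apply/andP; split; lra.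
move=> t /andP[t0 t1]; have [ts|st] := ltP t s; first by apply: f0; rewrite t0.
by apply: f1; rewrite t1 andbT (le_trans _ st)//; lra.
Qed.

End Lift.

Definition dm_slice (F : pred 'I_m) p : set 'rV[R]_m :=
  [set x | dmset S Z x /\ forall k, F k -> x 0 k = p 0 k].

(** If neither factor vanished, lift a segment from a point with [h <> 0] to one with [f <> 0]. Near
    the start [h] is nonzero, so [f] vanishes there, and by [lift_identity] also at the end. The
    lift stays in the slice because the coordinates in [F] are parameters. *)
Lemma slice_prime (F : pred 'I_m) p : (forall k, F k -> ~~ S k) ->
  dm_slice F p !=set0 -> prime_set (vanishing_ideal (dm_slice F p)).
Proof.
move=> FS [q Fq]; split; first exact: vanishing_ideal_set.
  by move=> /(_ q Fq); rewrite peval1 => /eqP; rewrite oner_eq0.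
move=> f h fh; apply: contrapT => /not_orP[nf nh].
have wit e : ~ vanishing_ideal (dm_slice F p) e -> exists2 x, dm_slice F p x & peval e x != 0.
  move=> ne; apply: contrapT => nx; apply: ne => x Fx; apply/eqP/negPn/negP => ex.
  by apply: nx; exists x.
have [x1 [X1 F1] f1] := wit f nf; have [x0 [X0 F0] h0] := wit h nh.
have [px0 _ Zx0] := X0; have [px1 _ Zx1] := X1.
have [g gL] := lift_exists Sdiag SZ px0 px1 Zx0 Zx1; have [gX gx gc gd] := gL.
have g0 : g 0 = x0.
  apply: (dmset_unique Sdiag (gX 0) X0) => k Sk.
  by rewrite gx ?lexx ?ler01// /segm subr0 scale1r scale0r addr0.
have g1 : g 1 = x1.
  apply: (dmset_unique Sdiag (gX 1) X1) => k Sk.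
  by rewrite gx ?lexx ?ler01// /segm subrr scale1r scale0r add0r.
have gF (t : R) : 0 <= t <= 1 -> dm_slice F p (g t).
  move=> tt; split=> // k Fk; rewrite gx ?FS// /segm !mxE F0// F1//; ring.
have : \forall t \near (0 : R), peval h (g t) != 0.
  have hc : peval h (g t) @[t --> (0 : R)] --> peval h (g 0) by exact: (lift_continuous gL).
  rewrite g0 in hc.
  exact: (cvgr_neq0 _ hc h0).
move=> /nbhs_ballP[e /= e0 he].
pose s := Num.min e 1.
have s01 : 0 < s <= 1 by rewrite lt_min e0 ltr01 ge_min lexx orbT.
have f0 (t : R) : 0 <= t < s -> peval f (g t) = 0.
  move=> /andP[t0]; rewrite lt_min => /andP[te t1].
  have ht : peval h (g t) != 0 by apply: he; rewrite /ball /= sub0r normrN ger0_norm.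
  have := fh (g t) (gF t _); rewrite t0 ltW// => /(_ isT) /eqP.
  by rewrite pevalM mulf_eq0 (negPf ht) orbF => /eqP.
have := lift_identity gL s01 f0 (t := 1); rewrite ler01 lexx g1 => /(_ isT) /eqP.
by rewrite (negPf f1).
Qed.

End Primality.

(** * Chains of prime ideals *)

Section LowestTerm.
Variables (R : realType) (m : nat).
Local Notation poly_m := (mpoly.mpoly m R).

(** Exponent vectors, nested so that induction can split off the first variable. *)
Fixpoint box (N k : nat) : finType :=
  if k is k'.+1 then ('I_N * box N k')%type else unit.

Lemma card_box N k : #|box N k| = (N ^ k)%N.
Proof. by elim: k => [|k IH] /=; rewrite ?card_unit// card_prod card_ord IH expnS. Qed.

Fixpoint bmon (N k : nat) (a : nat -> poly_m) : box N k -> poly_m :=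
  match k with
  | 0 => fun _ => 1
  | k'.+1 => fun e => a 0%N ^+ e.1 * bmon (fun i => a i.+1) e.2
  end.

Lemma prime_setX (P : set poly_m) f e : prime_set P -> P (f ^+ e) -> P f.
Proof.
move=> [_ P1 Pp]; elim: e => [|e IH]; first by rewrite expr0 => /P1.
by rewrite exprS => /Pp[].
Qed.

(* Eliminate the variables one by one: dividing a relation by the largest power
   of [a 0] and reducing modulo [P 1] leaves a relation between the others. *)
Lemma chain_indep (N k : nat) (P : nat -> set poly_m) (a : nat -> poly_m)
    (c : box N k -> R) :
  (forall i, (i <= k)%N -> prime_set (P i)) ->
  (forall i, (i < k)%N -> P i `<=` P i.+1) ->
  (forall i, (i < k)%N -> P i.+1 (a i) /\ ~ P i (a i)) ->
  P 0%N (\sum_e c e *: bmon a e) -> forall e, c e = 0.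
Proof.
elim: k P a c => [|k IH] P a c pP PS Pa.
  have [[P0 PD PM] P1 _] := pP 0%N (leqnn _).
  move=> h [] ; apply/eqP/negPn/negP => c0; apply: P1.
  have -> : 1 = mpoly.mpolyC m (c tt)^-1 * (\sum_e c e *: bmon a e) :> poly_m.
    rewrite (big_pred1 tt) => [|[]//] /=.
    by rewrite mpoly.mul_mpolyC scalerA mulVf// scale1r.
  exact: PM.
move=> h; apply: contrapT => /existsNP[[i0 e0] /eqP ce0].
have ex : exists i, [exists j : 'I_N, exists e, (j == i :> nat) && (c (j, e) != 0)].
  by exists i0; apply/existsP; exists i0; apply/existsP; exists e0; rewrite eqxx.
(* [j] is the lowest power of [a 0] that occurs. *)
have [i /existsP[j /existsP[e /andP[/eqP ji ce]]] imin] := ex_minnP ex.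
pose A (l : 'I_N) := \sum_e' c (l, e') *: bmon (fun i => a i.+1) e'.
have A0 (l : 'I_N) : (l < j)%N -> A l = 0.
  move=> lj; rewrite /A big1 // => e' _; have [->|cl] := eqVneq (c (l, e')) 0.
    by rewrite scale0r.
  have : (i <= l)%N.
    by apply: imin; apply/existsP; exists l; apply/existsP; exists e'; rewrite eqxx.
  by rewrite -ji leqNgt lj.
pose B := \sum_(l < N | (j < l)%N) a 0%N ^+ (l - j.+1) * A l.
have sumE : \sum_e c e *: bmon a e = a 0%N ^+ j * (A j + a 0%N * B).
  have -> : \sum_e c e *: bmon a e =
      \sum_(l < N) \sum_(e' : box N k) c (l, e') *: (a 0%N ^+ l * bmon (fun i => a i.+1) e').
    rewrite (pair_bigA _ (fun l e' => c (l, e') *: (a 0%N ^+ l * bmon (fun i => a i.+1) e'))) /=.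
    by apply: eq_bigr => -[l e'] _.
  rewrite (eq_bigr (fun l : 'I_N => a 0%N ^+ l * A l)); last first.
    by move=> l _; rewrite /A mulr_sumr; apply: eq_bigr => e' _; rewrite scalerAr.
  rewrite (bigD1 j) //= mulrDr; congr (_ + _).
  rewrite (bigID (fun l : 'I_N => (j < l)%N)) /= [X in _ + X]big1 ?addr0; last first.
    move=> l /andP[lj nl]; rewrite A0 ?mulr0// ltn_neqAle leqNgt nl andbT.
    exact: lj.
  rewrite /B 2!big_distrr /=; apply: eq_big => [l|l /andP[_ jl]].
    by rewrite andb_idl// => jl; apply: contraTneq jl => ->; rewrite ltnn.
  by rewrite !mulrA -exprSr -exprD subnKC.
have [[P0 PD PM] P1 Pp] := pP 0%N isT.
have [Pa1 nPa0] := Pa 0%N isT.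
move: h; rewrite sumE => /Pp[/prime_setX h|h]; first by apply: nPa0; apply: h; exact: pP.
have [[Q0 QD QM] Q1 Qp] := pP 1%N isT.
(* Both the cofactor of [a 0 ^+ j] and [a 0] lie in [P 1], which leaves [A j]. *)
have PAj : P 1%N (A j).
  rewrite -(addrK (a 0%N * B) (A j)); apply: QD; first exact: PS h.
  by rewrite -mulrN mulrC; apply: QM.
have := IH (fun i => P i.+1) (fun i => a i.+1) (fun e => c (j, e)) _ _ _ PAj e.
move=> /(_ (fun i => pP i.+1) (fun i => PS i.+1) (fun i => Pa i.+1)) ce'.
by rewrite ce' eqxx in ce.
Qed.

(** [mmeasure mdeg] is the degree plus one, and 0 at the zero polynomial; hence the successors. *)
Lemma msize_bmon (N k E : nat) (a : nat -> poly_m) (e : box N k) :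
  (forall i, (i < k)%N -> (mpoly.mmeasure mpoly.mdeg (a i) <= E.+1)%N) ->
  (mpoly.mmeasure mpoly.mdeg (bmon a e) <= (k * (N * E)).+1)%N.
Proof.
have mulle (f h : poly_m) u v : (mpoly.mmeasure mpoly.mdeg f <= u.+1)%N ->
    (mpoly.mmeasure mpoly.mdeg h <= v.+1)%N ->
    (mpoly.mmeasure mpoly.mdeg (f * h) <= (u + v).+1)%N.
  have [->|f0] := eqVneq f 0; first by rewrite mul0r mpoly.msize0.
  have [->|h0] := eqVneq h 0; first by rewrite mulr0 mpoly.msize0.
  move=> fu hv; rewrite mpoly.msizeM// -subn1 leq_subLR add1n.
  by rewrite -addSn -addnS; exact: leq_add.
elim: k a e => [|k IH] a e aE /=; first by rewrite mpoly.msize1.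
rewrite mulSn; apply: (mulle); last by apply: IH => i ik; exact: aE.
have aX j : (mpoly.mmeasure mpoly.mdeg (a 0%N ^+ j) <= (j * E).+1)%N.
  elim: j => [|j IHj]; first by rewrite expr0 mpoly.msize1.
  by rewrite exprS mulSn; apply: (mulle) => //; exact: aE.
by apply: (leq_trans (aX _)); rewrite ltnS leq_mul2r (ltnW (ltn_ord e.1)) orbT.
Qed.

End LowestTerm.

(** * The chain of slices and the lower bound *)

Section LowerBound.
Variables (R : realType) (n : nat) (S Z : pred 'I_(sym_dim n)).
Local Notation m := (sym_dim n).
Hypothesis Sdiag : forall i, ~~ S (kidx i i).
Hypothesis Zdiag : forall i, ~~ Z (kidx i i).
Hypothesis SZ : forall k, Z k -> ~~ S k.

Definition free_idx : pred 'I_m := fun k => ~~ S k && ~~ Z k.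

Definition idpoint : 'rV[R]_m := sym_coord 1%:M.

Lemma symmx_idpoint : symmx idpoint = 1%:M.
Proof. by rewrite symmxK// tr_scalar_mx. Qed.

Lemma idpoint_dmset : dmset S Z idpoint.
Proof.
split; first by rewrite symmx_idpoint; exact: posdef1.
  move=> k Sk; rewrite symmx_idpoint adj1 mxE.
  by rewrite (negPf (S_offdiag Sdiag Sk)).
move=> k Zk; rewrite -symmx_pidx symmx_idpoint mxE.
by rewrite (negPf (S_offdiag Zdiag Zk)).
Qed.

Lemma dmset_neq0 : (dmset S Z : set 'rV[R]_m) !=set0.
Proof. by exists idpoint; exact: idpoint_dmset. Qed.

Lemma dmset_prime : prime_set (vanishing_ideal (dmset S Z : set 'rV[R]_m)).
Proof.
have -> : dmset S Z = dm_slice S Z pred0 idpoint.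
  by apply/seteqP; split => [x Xx|x []].
by apply: slice_prime => //; exists idpoint; split => //; exact: idpoint_dmset.
Qed.

(** Fix the parameters one by one at their values in the identity matrix. Each step is strict:
    completing a small shift of the identity in the next parameter gives a point of the larger slice
    outside the smaller one. *)
Lemma dmset_prime_chain : prime_chain (vanishing_ideal (dmset S Z : set 'rV[R]_m)) #|free_idx|.
Proof.
pose s := enum free_idx.
pose F i : pred 'I_m := fun k => k \in take i s.
have Ffree i k : F i k -> ~~ S k && ~~ Z k by move=> /mem_take; rewrite mem_enum.
have Fid i : dm_slice S Z (F i) idpoint idpoint by split => //; exact: idpoint_dmset.
exists (fun i => vanishing_ideal (dm_slice S Z (F i) idpoint)); split.
- move=> i _; apply: slice_prime => //; last by exists idpoint.
  by move=> k /Ffree/andP[].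
- by apply: vanishing_idealS => x [].
- move=> i ic; have is_ : (i < size s)%N by rewrite -cardE.
  have [k0 _] : exists k0, k0 \in free_idx by apply/card_gt0P; exact: leq_ltn_trans ic.
  have FS : F i.+1 =1 predU1 (nth k0 s i) (F i).
    by move=> l; rewrite /F (take_nth k0)// mem_rcons inE.
  set k := nth k0 s i in FS.
  have kF : ~~ F i k.
    rewrite /F; apply/negP => kin; have := enum_uniq free_idx.
    rewrite -/s -(cat_take_drop i s) (drop_nth k0 is_) cat_uniq => /and3P[_ /hasPn h _].
    by have := h k (mem_head _ _); rewrite kin.
  have /andP[Sk Zk] : ~~ S k && ~~ Z k by have := mem_nth k0 is_; rewrite mem_enum.
  split.
    apply: vanishing_idealS => x [Xx Fx]; split => // l Fl.
    by apply: Fx; rewrite FS /= Fl orbT.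
  pose f : mpoly.mpoly m R := mpoly.mpolyX R (mpoly.mnm1 k) - mpoly.mpolyC m (idpoint 0 k).
  move=> /(_ f) h; have : vanishing_ideal (dm_slice S Z (F i) idpoint) f.
    by apply: h => x [_ Fx]; rewrite pevalB pevalC pevalX Fx ?subrr// FS /= eqxx.
  have [e e0 pe] := posdef_line (let: And3 h _ _ := idpoint_dmset in h)
    (symmx_tr (delta_mx 0 k : 'rV[R]_m)).
  pose y := idpoint + (e / 2) *: delta_mx 0 k.
  have py : posdef (symmx y).
    by rewrite symmxD symmxZ; apply: pe; rewrite ger0_norm; lra.
  have yE l : l != k -> y 0 l = idpoint 0 l.
    by move=> lk; rewrite !mxE /= (negPf lk) mulr0 addr0.
  have Zy l : Z l -> y 0 l = 0.
    move=> Zl; rewrite yE; first by case: idpoint_dmset => _ _; apply.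
    by apply: contraNneq Zk => <-.
  have [x [Xx xy _]] := dempster Sdiag SZ py Zy.
  have yk : y 0 k = idpoint 0 k + e / 2.
    by rewrite [LHS]mxE; congr (_ + _); rewrite !mxE !eqxx mulr1.
  move=> /(_ x); rewrite pevalB pevalC pevalX xy// yk addrAC subrr add0r.
  move=> hx; have : e / 2 = 0; last by lra.
  apply: hx; split => // l Fl; rewrite xy; last by case/andP: (Ffree _ _ Fl).
  by rewrite yE//; apply: contraTneq Fl => ->.
Qed.

End LowerBound.

(** * Algebraic dependence *)

Section Dependence.
Variables (R : realType) (n : nat) (S Z : pred 'I_(sym_dim n)).
Local Notation m := (sym_dim n).
Local Notation poly_m := (mpoly.mpoly m R).
Local Notation msz := (mpoly.mmeasure mpoly.mdeg).
Hypothesis Sdiag : forall i, ~~ S (kidx i i).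
Hypothesis Zdiag : forall i, ~~ Z (kidx i i).
Hypothesis SZ : forall k, Z k -> ~~ S k.

Local Notation adjp k := (\adj (symvar R n) (pidx k).1 (pidx k).2).

Definition perturbed (N : nat) (eps : R) : set 'rV[R]_m :=
  [set y | (forall k, S k ->
      2 * \adj (symmx y) (pidx k).1 (pidx k).2 = eps * N.*2.+2%:R * y 0 k ^+ N.*2.+1) /\
    forall k, Z k -> y 0 k = 0].

Section NormalForm.
Variables (N M : nat) (eps : R).
Hypothesis eps0 : 0 < eps.
Hypothesis Nbig : forall k, (msz (adjp k) <= N.*2.+1)%N.

(** The exponent type is a common finite range; only the parameters have exponents that grow with
    [M]. *)
Definition reduced : {pred {ffun 'I_m -> 'I_(M + N.*2.+1).+1}} :=
  family (fun k => if S k then [pred e : 'I_(M + N.*2.+1).+1 | (e < N.*2.+1)%N]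
                   else if Z k then [pred e : 'I_(M + N.*2.+1).+1 | (e < 1)%N]
                   else [pred e : 'I_(M + N.*2.+1).+1 | (e < M.+1)%N]).

Lemma card_reduced : (#|reduced| <= N.*2.+1 ^ #|S| * M.+1 ^ #|free_idx S Z|)%N.
Proof.
rewrite card_family.
have cardlt b : (#|[pred e : 'I_(M + N.*2.+1).+1 | (e < b)%N]| <= b)%N.
  have inj : injective (fun e : {e : 'I_(M + N.*2.+1).+1 | (e < b)%N} => Ordinal (valP e)).
    by move=> e e' /(congr1 val) /= h; do 2 apply: val_inj.
  by have := leq_card _ inj; rewrite card_ord card_sig.
rewrite foldrE big_map big_enum /=.
have le (P : pred 'I_m) (F : 'I_m -> nat) b : (forall k, P k -> (F k <= b)%N) ->
    (\prod_(k | P k) F k <= b ^ #|P|)%N.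
  by move=> Fb; rewrite -prod_nat_const; apply: leq_prod.
rewrite (bigID S) /= leq_mul//; first by apply: le => k Sk; rewrite Sk; exact: cardlt.
rewrite (bigID Z) /= -[X in (_ <= X)%N]mul1n leq_mul//; last first.
  by apply: le => k /andP[/negPf-> /negPf->]; exact: cardlt.
rewrite -[X in (_ <= X)%N](exp1n #|[pred k | ~~ S k && Z k]|).
by apply: le => k /andP[/negPf-> ->]; exact: cardlt.
Qed.

Definition mono_val (b : {ffun 'I_m -> 'I_(M + N.*2.+1).+1}) (y : 'rV[R]_m) : R :=
  \prod_k y 0 k ^+ b k.

Definition spanned (phi : 'rV[R]_m -> R) : Prop :=
  exists kappa : {ffun 'I_m -> 'I_(M + N.*2.+1).+1} -> R,
    forall y, perturbed N eps y -> phi y = \sum_(b in reduced) kappa b * mono_val b y.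

Lemma spanned0 : spanned (fun=> 0).
Proof. by exists (fun=> 0) => y _; rewrite big1 // => b _; rewrite mul0r. Qed.

Lemma spannedD phi psi : spanned phi -> spanned psi -> spanned (fun y => phi y + psi y).
Proof.
move=> [k1 h1] [k2 h2]; exists (fun b => k1 b + k2 b) => y Ey.
by rewrite h1// h2// -big_split; apply: eq_bigr => b _; rewrite mulrDl.
Qed.

Lemma spannedZ c phi : spanned phi -> spanned (fun y => c * phi y).
Proof.
move=> [k h]; exists (fun b => c * k b) => y Ey.
by rewrite h// mulr_sumr; apply: eq_bigr => b _; rewrite mulrA.
Qed.

Lemma spanned_ext phi psi : (forall y, perturbed N eps y -> phi y = psi y) ->
  spanned psi -> spanned phi.
Proof. by move=> e [k h]; exists k => y Ey; rewrite e// h. Qed.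

(* On the perturbed system the power [y_k ^ (2N+1)], k in S, is a multiple of an
   entry of the adjugate, which has smaller degree. *)
Lemma normal_form (j : nat) (f : poly_m) : (j <= M.+1)%N -> (msz f <= j)%N ->
  spanned (peval f).
Proof.
elim: j f => [|j IH] f jM.
  rewrite leqn0 mpoly.mmeasure_poly_eq0 => /eqP ->.
  by apply: spanned_ext spanned0 => y _; rewrite peval0.
move=> fj; have {}IH g : (msz g <= j)%N -> spanned (peval g).
  by apply: IH; exact: ltnW.
suff mono a : (mpoly.mdeg a <= j)%N -> spanned (peval (mpoly.mpolyX R a)).
  have fa : {in mpoly.msupp f, forall a, (mpoly.mdeg a <= j)%N}.
    by move=> a /mpoly.msize_mdeg_lt af; rewrite -ltnS (leq_trans af).
  rewrite [f]mpoly.mpolyE; elim: (mpoly.msupp f) fa => [|a s IHs] fa.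
    by apply: spanned_ext spanned0 => y _; rewrite big_nil peval0.
  apply: (spanned_ext (psi := fun y => mpoly.mcoeff a f * peval (mpoly.mpolyX R a) y
     + peval (\sum_(b <- s) mpoly.mcoeff b f *: mpoly.mpolyX R b) y)).
    by move=> y _; rewrite big_cons pevalD pevalZ.
  apply: spannedD; first by apply/spannedZ/mono/fa; rewrite mem_head.
  by apply: IHs => b bs; apply: fa; rewrite inE bs orbT.
move=> aj; have XE y : peval (mpoly.mpolyX R a) y = \prod_k y 0 k ^+ a k.
  exact: mpoly.mevalX.
have [[k Zk ak]|noZ] := pselect (exists2 k, Z k & (0 < a k)%N).
  apply: spanned_ext spanned0 => y [_ Zy].
  by rewrite XE (bigD1 k) //= Zy// expr0n -leqn0 leqNgt ak mul0r.
have [[k Sk ak]|noS] := pselect (exists2 k, S k & (N.*2.+1 <= a k)%N).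
  pose b := mpoly.mnm_sub a (mpoly.mnm_muln (mpoly.mnm1 k) N.*2.+1).
  have ba : a = mpoly.mnm_add b (mpoly.mnm_muln (mpoly.mnm1 k) N.*2.+1).
    rewrite mpoly.submK//; apply/mpoly.mnm_lepP => l; rewrite mpoly.mulmnE mpoly.mnm1E.
    by case: eqP => [<-|_]; rewrite ?mul1n ?mul0n.
  have adeg : mpoly.mdeg a = (mpoly.mdeg b + N.*2.+1)%N.
    by rewrite {1}ba mpoly.mdegD mpoly.mdegMn mpoly.mdeg1 mul1n.
  pose q : R := eps * N.*2.+2%:R.
  have q0 : q != 0 by rewrite mulf_neq0 ?gt_eqF// ltr0n.
  apply: (spanned_ext (psi := fun y => (2 / q) * peval (mpoly.mpolyX R b * adjp k) y)).
    move=> y [Sy _]; rewrite {1}ba mpoly.mpolyXD !pevalM peval_adj.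
    have -> : peval (mpoly.mpolyX R (mpoly.mnm_muln (mpoly.mnm1 k) N.*2.+1)) y = y 0 k ^+ N.*2.+1.
      by rewrite -mpoly.mpolyXn /peval rmorphXn /= -/(peval _ _) pevalX.
    have -> : y 0 k ^+ N.*2.+1 = (2 / q) * \adj (symmx y) (pidx k).1 (pidx k).2.
      by rewrite mulrAC Sy// -/q mulrAC divff// mul1r.
    by rewrite mulrCA.
  apply/spannedZ/IH; have [->|adj0] := eqVneq (adjp k) 0.
    by rewrite mulr0 mpoly.msize0.
  have X0 : mpoly.mpolyX R b != 0.
    by rewrite -mpoly.msize_poly_eq0 mpoly.msizeX.
  rewrite mpoly.msizeM// mpoly.msizeX addSn /=.
  by apply: leq_trans aj; rewrite adeg leq_add2l.
have aM k : (a k < (M + N.*2.+1).+1)%N.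
  rewrite ltnS (leq_trans _ (leq_addr _ _))// -ltnS (leq_trans _ jM)// ltnS.
  by apply: leq_trans aj; rewrite mpoly.mdegE (bigD1 k) //= leq_addr.
pose b : {ffun 'I_m -> 'I_(M + N.*2.+1).+1} := [ffun k => Ordinal (aM k)].
have bred : b \in reduced.
  apply/familyP => k; rewrite ffunE; case: ifPn => Sk.
    by rewrite inE /= ltnNge; apply/negP => ak; apply: noS; exists k.
  case: ifPn => Zk; rewrite inE /=.
    by rewrite ltnNge; apply/negP => ak; apply: noZ; exists k.
  apply: leq_trans jM; rewrite ltnS; apply: leq_trans aj.
  by rewrite mpoly.mdegE (bigD1 k) //= leq_addr.
exists (fun b' => (b' == b)%:R) => y _.
rewrite XE (bigD1 b) //= eqxx mul1r [X in _ = _ + X]big1 ?addr0.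
  by rewrite /mono_val; apply: eq_bigr => k _; rewrite ffunE.
by move=> b' /andP[_ /negPf->]; rewrite mul0r.
Qed.

End NormalForm.

Local Notation d := #|free_idx S Z|.

(** There are [L^(d+1)] monomials in the [a i], and they lie in the span of at most a constant times
    [L^d] reduced ones. [L] is chosen before [eps], which makes a limit possible. *)
Lemma perturbed_dependence (N E : nat) (a : nat -> poly_m) :
  (forall k, (msz (adjp k) <= N.*2.+1)%N) ->
  (forall i, (i < d.+1)%N -> (msz (a i) <= E.+1)%N) ->
  exists L, forall eps : R, 0 < eps ->
    exists c : box L d.+1 -> R, (exists e, c e != 0) /\
      forall y, perturbed N eps y -> \sum_e c e * peval (bmon a e) y = 0.
Proof.
move=> Nbig aE.
(* The degrees are at most [M] with [M + 1 <= L C], so [(2N+1)^|S| C^d] is the constant that [L] has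
   to exceed. *)
pose C := (d.+1 * E).+1.
pose L := (N.*2.+1 ^ #|S| * C ^ d).+1.
exists L => eps eps0; pose M := (d.+1 * (L * E))%N.
have big : (#|@reduced N M| < #|box L d.+1|)%N.
  rewrite card_box; apply: (leq_ltn_trans (card_reduced _ _)).
  have ML : (M.+1 <= L * C)%N by rewrite /M /C mulnS mulnCA -add1n leq_add.
  have := leq_exp2r M.+1 (L * C) => h.
  have M1 : (M.+1 ^ d <= (L * C) ^ d)%N.
    by case: (posnP d) => [->|dp]; [rewrite !expn0 | rewrite leq_exp2r].
  apply: (leq_ltn_trans (leq_mul (leqnn _) M1)).
  rewrite expnMn mulnCA expnS mulnC ltn_pmul2r ?expn_gt0//.
have /choice[kap kapP] : forall e : box L d.+1,
    exists kappa : {ffun 'I_m -> 'I_(M + N.*2.+1).+1} -> R,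
    forall y, perturbed N eps y ->
      peval (bmon a e) y = \sum_(b in @reduced N M) kappa b * mono_val b y.
  move=> e; apply: (normal_form eps0 Nbig (leqnn _)).
  by apply: msize_bmon => i id; exact: aE.
pose K : 'M[R]_(#|box L d.+1|, #|@reduced N M|) :=
  \matrix_(i, j) kap (enum_val i) (enum_val j).
have /rowV0Pn[v /sub_kermxP vK v0] : kermx K != 0.
  rewrite -mxrank_eq0 mxrank_ker subn_eq0 -ltnNge.
  exact: leq_ltn_trans (rank_leq_col K) big.
exists (fun e => v 0 (enum_rank e)); split.
  apply: contrapT => /forallNP h; move/eqP: v0; apply; apply/rowP => i.
  by rewrite mxE -[i]enum_valK; apply/eqP/negPn/negP => /h.
move=> y Ey.
transitivity (\sum_e \sum_(b in @reduced N M) (v 0 (enum_rank e) * kap e b) * mono_val b y).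
  apply: eq_bigr => e _; rewrite (kapP e y Ey) mulr_sumr.
  by apply: eq_bigr => b _; rewrite mulrA.
rewrite exchange_big big1 //= => b bred; rewrite -mulr_suml.
suff -> : \sum_e v 0 (enum_rank e) * kap e b = 0 by rewrite mul0r.
have := congr1 (fun w : 'rV_(#|@reduced N M|) => w 0 (enum_rank_in bred b)) vK.
rewrite !mxE => vK0; rewrite -[RHS]vK0 [RHS](reindex (@enum_rank (box L d.+1))) /=; last first.
  exact/onW_bij/enum_rank_bij.
by apply: eq_bigr => e _; rewrite mxE enum_rankK enum_rankK_in.
Qed.

End Dependence.

(** * Limits of relations and the upper bound *)

Section UpperBound.
Variables (R : realType) (n : nat) (S Z : pred 'I_(sym_dim n)).
Local Notation m := (sym_dim n).
Local Notation poly_m := (mpoly.mpoly m R).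
Local Notation msz := (mpoly.mmeasure mpoly.mdeg).
Hypothesis Sdiag : forall i, ~~ S (kidx i i).
Hypothesis Zdiag : forall i, ~~ Z (kidx i i).
Hypothesis SZ : forall k, Z k -> ~~ S k.
Local Notation d := #|free_idx S Z|.
Local Notation adj_at y k := (\adj (symmx y) (pidx k).1 (pidx k).2).

Lemma cvg_sumr (T : Type) (F : set_system T) (I : finType) (f : I -> T -> R) (l : I -> R) :
  Filter F -> (forall i, f i @ F --> l i) ->
  (fun t => \sum_i f i t) @ F --> (\sum_i l i : R).
Proof.
by move=> FF h; apply: cvg_big => //; exact: add_continuous.
Qed.

(** The perturbed critical points in the fibre of [x] eventually have determinants bounded below,
    and their adjugate entries in [S] tend to 0; then [dmset_limit] applies. *)
Lemma perturbed_approximation (N : nat) (x : 'rV[R]_m) (eps : nat -> R)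
    (G : set_system nat) : UltraFilter G -> (forall i, 0 < eps i) ->
  eps @ G --> (0 : R) -> dmset S Z x ->
  exists y : nat -> 'rV[R]_m, G [set i | perturbed S Z N (eps i) (y i)] /\ y @ G --> x.
Proof.
move=> GU eps0 epsc Xx; have [px ax zx] := Xx; have dx := posdef_det_gt0 px.
have GF : Filter G by exact: filter_filter.
have /choice[y yP] : forall i, exists y, [/\ psd (symmx y),
    forall k, ~~ S k -> y 0 k = x 0 k,
    \det (symmx x) - eps i * \sum_(k | S k) x 0 k ^+ N.*2.+2 <= \det (symmx y) &
    0 < \det (symmx y) -> forall k, S k ->
      2 * adj_at y k = eps i * N.*2.+2%:R * y 0 k ^+ N.*2.+1].
  by move=> i; apply: perturbed_critical => //; exact: ltW.
set Q := \sum_(k | S k) _ in yP.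
have dety : G [set i | \det (symmx x) / 2 <= \det (symmx (y i))].
  have : (fun i => \det (symmx x) - eps i * Q) @ G --> (\det (symmx x) - 0 * Q : R).
    by apply: cvgB; [exact: cvg_cst | apply: cvgM => //; exact: cvg_cst].
  rewrite mul0r subr0 => h.
  have : \forall i \near G, \det (symmx x) / 2 < \det (symmx x) - eps i * Q.
    by apply: (cvgr_gt _ h); rewrite ltr_pdivrMr// mulr_natr mulr2n ltrDl.
  by apply: filterS => i /ltW hi; have [_ _ di _] := yP i; exact: le_trans di.
have boxy i : psd_box (\sum_i `|x 0 (kidx i i)|) (y i).
  by have [pi_ yi _ _] := yP i; apply: psd_fibre_box => //; exact: Sdiag.
have pert : G [set i | perturbed S Z N (eps i) (y i)].
  apply: filterS dety => i di; have [_ yi _ ci] := yP i; split.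
    by apply: ci; apply: lt_le_trans di; rewrite divr_gt0.
  by move=> k Zk; rewrite yi ?SZ// zx.
exists y; split => //.
apply: (@dmset_limit R n S Z Sdiag SZ nat G y x (\sum_i `|x 0 (kidx i i)|)
  (\det (symmx x) / 2) GU) => //; first by rewrite divr_gt0.
- by apply: filterS dety.
- move=> k Sk.
  have [z [_ _] yz] := @psd_box_limit R n nat G y _ GU (@filterE _ G GF _ boxy).
  have yk : (fun i => y i 0 k) @ G --> (z 0 k : R).
    exact: coord_cvg.
  (* At a perturbed point the adjugate entry is [eps] times [f], and [f] converges. *)
  pose f : poly_m := mpoly.mpolyC m (N.*2.+2%:R / 2) * mpoly.mpolyX R (mpoly.mnm1 k) ^+ N.*2.+1.
  have fy v : peval f v = N.*2.+2%:R / 2 * v 0 k ^+ N.*2.+1.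
    by rewrite pevalM pevalC /peval rmorphXn /= -/(peval _ _) pevalX.
  have fc : peval f (y i) @[i --> G] --> peval f z.
    by apply: peval_cvg => l; exact: coord_cvg.
  have h : (fun i => eps i * peval f (y i)) @ G --> (0 * peval f z : R) by exact: cvgM.
  rewrite mul0r in h; apply: cvg_trans h; apply: near_eq_cvg.
  apply: filterS pert => i [/(_ k Sk) e _]; rewrite fy.
  have -> : adj_at (y i) k = 2 * adj_at (y i) k / 2 by rewrite mulrAC divff ?mul1r.
  by rewrite e; ring.
- move=> k Sk; rewrite (_ : (fun t => _) = fun=> x 0 k); first exact: cvg_cst.
  by apply/funext => i; have [_ h _ _] := yP i; rewrite h.
Qed.

(* Normalized relations on the perturbed systems, whose size does not depend on
   [eps], converge along an ultrafilter as [eps] tends to 0. *)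
Theorem dmset_dependence (a : nat -> poly_m) : exists L (c : box L d.+1 -> R),
  (exists e, c e != 0) /\ vanishing_ideal (dmset S Z) (\sum_e c e *: bmon a e).
Proof.
pose N := (\sum_k msz (\adj (symvar R n) (pidx k).1 (pidx k).2))%N.
have Nbig k : (msz (\adj (symvar R n) (pidx k).1 (pidx k).2) <= N.*2.+1)%N.
  apply: leqW; rewrite -addnn; apply: leq_trans (leq_addr _ _).
  by rewrite /N (bigD1 k) //= leq_addr.
pose E := (\sum_(i < d.+1) msz (a i))%N.
have aE i : (i < d.+1)%N -> (msz (a i) <= E.+1)%N.
  by move=> id; apply: leqW; rewrite /E (bigD1 (Ordinal id)) //= leq_addr.
have [L dep] := perturbed_dependence Nbig aE.
pose eps (i : nat) : R := i.+1%:R^-1.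
have eps0 i : 0 < eps i by rewrite invr_gt0 ltr0n.
have /choice[c cP] : forall i, exists c : box L d.+1 -> R, \sum_e `|c e| = 1 /\
    forall y, perturbed S Z N (eps i) y -> \sum_e c e * peval (bmon a e) y = 0.
  move=> i; have [c [[e0 ce0] cy]] := dep _ (eps0 i).
  (* Coefficients of absolute sum 1 cannot all tend to 0. *)
  pose s := \sum_e `|c e|.
  have s0 : 0 < s.
    by rewrite /s (bigD1 e0) //= ltr_pwDl ?normr_gt0// sumr_ge0.
  exists (fun e => s^-1 * c e); split.
    rewrite (eq_bigr (fun e => s^-1 * `|c e|)) => [|e _]; last first.
      by rewrite normrM gtr0_norm ?invr_gt0.
    by rewrite -mulr_sumr -/s mulVf// gt_eqF.
  move=> y Ey; rewrite (eq_bigr (fun e => s^-1 * (c e * peval (bmon a e) y))) => [|e _].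
    by rewrite -mulr_sumr cy// mulr0.
  by rewrite mulrA.
have [G [GU ooG]] := ultraFilterLemma (@eventually_filter).
have GF : Filter G by exact: filter_filter.
have epsc : eps @ G --> (0 : R).
  by move=> A hA; apply: ooG; exact: (@cvg_harmonic R A hA).
have cle e i : -1 <= c i e <= 1.
  rewrite -ler_norml; have [<- _] := cP i.
  by rewrite (bigD1 e) //= lerDl sumr_ge0.
have /choice[z zP] : forall e, exists z : R, c i e @[i --> G] --> z.
  move=> e; have [|z _ zc] := @ultra_compact_limit nat R G (fun i => c i e) `[-1, 1] GU
      (@segment_compact _ _ _); last by exists z.
  by apply: filterE => i /=; rewrite in_itv /=; exact: cle.
have PG : ProperFilter G by exact: ultra_proper.
exists L, z; split.
  apply: contrapT => /forallNP z0.
  have : (fun i => \sum_e `|c i e|) @ G --> (\sum_e `|z e| : R).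
    by apply: cvg_sumr => e; apply: cvg_norm; exact: zP.
  rewrite [X in _ --> X]big1 => [|e _]; last first.
    by apply/eqP; rewrite normr_eq0; apply/negPn/negP => /z0.
  rewrite (_ : (fun i => _) = fun=> 1); last by apply/funext => i; case: (cP i).
  have h1 : (fun=> 1 : R) @ G --> (1 : R) by exact: cvg_cst.
  move=> h0; have e10 : (1 : R) = 0 := @cvg_unique _ (@Rhausdorff R) _ _ _ _ h1 h0.
  by have := @oner_neq0 R; rewrite e10 eqxx.
move=> x Xx; have [y [Ey yx]] := perturbed_approximation N GU eps0 epsc Xx.
rewrite peval_sum; under eq_bigr do rewrite pevalZ.
have h : (fun i => \sum_e c i e * peval (bmon a e) (y i)) @ G -->
    (\sum_e z e * peval (bmon a e) x : R).
  apply: cvg_sumr => e; apply: cvgM; first exact: zP.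
  by apply: peval_cvg => k; exact: coord_cvg.
have h0 : (fun i => \sum_e c i e * peval (bmon a e) (y i)) @ G --> (0 : R).
  apply: (@cvg_trans _ ((fun=> 0 : R) @ G)); last exact: cvg_cst.
  apply: near_eq_cvg; apply: filterS Ey => i Ei.
  by have [_ ci] := cP i; rewrite ci.
exact: (@cvg_unique _ (@Rhausdorff R) _ _ _ _ h h0).
Qed.

(** Elements [a i] of [P (i + 1)] outside [P i] are independent modulo [P 0] by [chain_indep], but
    [d + 1] of them satisfy a relation on the model. *)
Theorem dmset_chain_le k : prime_chain (vanishing_ideal (dmset S Z : set 'rV[R]_m)) k ->
  (k <= d)%N.
Proof.
move=> [P [P1 P2 P3]]; rewrite leqNgt; apply/negP => dk.
have /choice[a aP] : forall i, exists f, (i < k)%N -> P i.+1 f /\ ~ P i f.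
  move=> i; have [ik|] := boolP (i < k)%N; last by exists 0.
  have [_ nP] := P3 i ik; apply: contrapT => /forallNP h; apply: nP => f Pf.
  by apply: contrapT => nf; apply: (h f).
have [L [c [[e ce] cX]]] := dmset_dependence a.
have := @chain_indep R m L d.+1 P a c _ _ _ _ e.
move=> h; move/eqP: ce; apply; apply: h.
- by move=> i id; apply: P1; exact: leq_trans id dk.
- by move=> i id; case: (P3 i (leq_trans id dk)).
- by move=> i id; apply: aP; exact: leq_trans id dk.
- exact: P2.
Qed.

Theorem dmset_dimension : dimension (dmset S Z : set 'rV[R]_m) = d%:R%:E.
Proof.
apply/eqP; rewrite eq_le; apply/andP; split; first exact: dimension_le dmset_chain_le.
apply: dimension_ge; first exact: dmset_neq0.
exact: dmset_prime_chain.
Qed.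

End UpperBound.

(** * Tangent spaces *)

Section Smoothness.
Variables (R : realType) (n : nat) (S Z : pred 'I_(sym_dim n)).
Local Notation m := (sym_dim n).
Local Notation poly_m := (mpoly.mpoly m R).
Hypothesis Sdiag : forall i, ~~ S (kidx i i).
Hypothesis Zdiag : forall i, ~~ Z (kidx i i).
Hypothesis SZ : forall k, Z k -> ~~ S k.
Local Notation d := #|free_idx S Z|.
Implicit Types (p v : 'rV[R]_m) (f : poly_m).

(** Up to a factor, [v] is the velocity at [p] of a lifted segment with midpoint [p], along which
    [f] vanishes. *)
Lemma differential_dmset p v f : dmset S Z p -> vanishing_ideal (dmset S Z) f ->
  (forall k, ~~ free_idx S Z k -> (jac_mx S p p *m v^T) k 0 = 0) ->
  \sum_k v 0 k * peval (mpoly.mderiv k f) p = 0.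
Proof.
move=> Xp fX Jv; have [pp ap zp] := Xp; have Ju := jac_mx_unit Sdiag pp pp.
pose D : 'rV[R]_m := \row_k if S k then 0 else v 0 k.
have DZ k : Z k -> D 0 k = 0.
  move=> Zk; rewrite mxE (negPf (SZ Zk)); have := Jv k.
  by rewrite /free_idx Zk andbF => /(_ isT); rewrite jac_mx_mul (negPf (SZ Zk)).
have [e e0 pe] := posdef_line pp (symmx_tr D).
have half_e : `|e / 2| < e by rewrite ger0_norm; lra.
have px1 : posdef (symmx (p + (e / 2) *: D)) by rewrite symmxD symmxZ; exact: pe.
have px0 : posdef (symmx (p + (- (e / 2)) *: D)).
  by rewrite symmxD symmxZ; apply: pe; rewrite normrN.
have [||g gL] := lift_exists Sdiag SZ px0 px1.
- by move=> k Zk; rewrite mxE zp// add0r mxE DZ// mulr0.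
- by move=> k Zk; rewrite mxE zp// add0r mxE DZ// mulr0.
have [gX gx gc gd] := gL.
have h01 : 0 < (1 / 2 : R) < 1 by apply/andP; split; lra.
have h01' : 0 <= (1 / 2 : R) <= 1 by apply/andP; split; lra.
have gp : g (1 / 2) = p.
  apply: (dmset_unique Sdiag (gX _) Xp) => k Sk.
  by rewrite gx// /segm !mxE; field.
have [_ D1] := peval_is_derive f (fun k => gd (1 / 2) k h01).
have [_ D0] : is_derive (1 / 2 : R) (1 : R) (fun s => peval f (g s)) 0.
  rewrite (_ : (fun s => _) = cst 0); first exact: is_derive_cst.
  by apply/funext => t; rewrite fX.
rewrite D1 gp in D0; move: D0.
(* The endpoints differ by [e D], and the hypothesis on [v] makes [D] the image of [v] under the
   Jacobian. *)
have vE k : velocity S (p + (e / 2) *: D - (p + (- (e / 2)) *: D)) p k 0 = e * v 0 k.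
  rewrite /velocity; have -> : free_part S (p + (e / 2) *: D - (p + (- (e / 2)) *: D)) =
     e *: (jac_mx S p p *m v^T).
    apply/colP => l; rewrite mxE [RHS]mxE jac_mx_mul.
    case: ifPn => Sl.
      by have := Jv l; rewrite jac_mx_mul Sl /free_idx Sl => ->//; rewrite mulr0.
    by rewrite !mxE (negPf Sl); field.
  by rewrite -scalemxAr mulKmx// !mxE.
under [X in X = _ -> _]eq_bigr do rewrite vE -mulrA.
by rewrite -mulr_sumr => /eqP; rewrite mulf_eq0 gt_eqF// => /eqP.
Qed.

(** Apply the hypothesis to the adjugate entries in [S] and the coordinates in [Z]: up to factors
    their differentials are rows of [jac_mx]. *)
Lemma differential_free p v : dmset S Z p ->
  (forall f, vanishing_ideal (dmset S Z) f -> \sum_k v 0 k * peval (mpoly.mderiv k f) p = 0) ->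
  forall k, ~~ free_idx S Z k -> (jac_mx S p p *m v^T) k 0 = 0.
Proof.
move=> Xp dv k; have [pp ap zp] := Xp; rewrite negb_and !negbK jac_mx_mul.
case: ifPn => [Sk _|Sk /= Zk].
  have adjX : vanishing_ideal (dmset S Z) (\adj (symvar R n) (pidx k).1 (pidx k).2).
    by move=> x [_ ax _]; rewrite peval_adj ax.
  have := dv _ adjX => /(congr1 ( *%R (\det (symmx p)))); rewrite mulr0 mulr_sumr.
  under eq_bigr do rewrite mulrCA (peval_mderiv_adj _ (ap k Sk)) mulrN.
  rewrite sumrN => /eqP; rewrite oppr_eq0 => /eqP dv0.
  rewrite adj_form_sum summxE.
  transitivity (2 * \sum_j v 0 j * (\adj (symmx p) *m symmx (delta_mx 0 j)
      *m \adj (symmx p)) (pidx k).1 (pidx k).2); last by rewrite dv0 mulr0.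
  rewrite mulr_sumr; apply: eq_bigr => j _.
  by rewrite [LHS]mxE /adj_form [X in _ * X]mxE; ring.
have XZ : vanishing_ideal (dmset S Z) (mpoly.mpolyX R (mpoly.mnm1 k)).
  by move=> x [_ _ zx]; rewrite pevalX zx.
have := dv _ XZ; rewrite (bigD1 k) //= big1 => [|j jk].
  by rewrite addr0 mderiv_var eqxx peval1 mulr1.
by rewrite mderiv_var eq_sym (negPf jk) peval0 mulr0.
Qed.

(** By the two preceding lemmas the tangent vectors are those that the invertible [J] maps to
    vectors supported on the parameters. *)
Lemma tangent_rank r (f : 'I_r -> poly_m) p : dmset S Z p ->
  vanishing_ideal (dmset S Z) = generated_ideal f -> \rank (tangent_space f p) = d.
Proof.
move=> Xp If; have [pp ap zp] := Xp; have Ju := jac_mx_unit Sdiag pp pp.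
set J := jac_mx S p p in Ju.
(* [A] selects the parameters; the rows of [W] are the preimages of the corresponding basis vectors
   under [J]. *)
pose A : 'M[R]_(d, m) := \matrix_(i, k) (enum_val i == k)%:R.
pose W := A *m (invmx J)^T.
have JJ : (invmx J)^T *m J^T = 1%:M by rewrite -trmx_mul mulmxV// trmx1.
have JJ' : J^T *m (invmx J)^T = 1%:M by rewrite -trmx_mul mulVmx// trmx1.
have AA : A *m A^T = 1%:M.
  apply/matrixP => i j; rewrite !mxE (bigD1 (enum_val i)) //= big1 => [|k ki].
    by rewrite !mxE eqxx mul1r addr0 eq_sym (inj_eq enum_val_inj).
  by rewrite !mxE eq_sym (negPf ki) mul0r.
have rW : \rank W = d.
  apply/eqP; apply/row_freeP; exists (J^T *m A^T).
  by rewrite /W mulmxA -[A *m _ *m _]mulmxA JJ mulmx1.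
have fX i : vanishing_ideal (dmset S Z) (f i).
  rewrite If; exists (fun j => (j == i)%:R); rewrite (bigD1 i) //= eqxx mul1r big1 ?addr0//.
  by move=> j /negPf ->; rewrite mul0r.
have jacE v i : (v *m (poly_jacobian f p)^T) 0 i = \sum_k v 0 k * peval (mpoly.mderiv k (f i)) p.
  by rewrite mxE; apply: eq_bigr => k _; rewrite !mxE.
have supp v : (forall k, ~~ free_idx S Z k -> (J *m v^T) k 0 = 0) -> (v <= W)%MS.
  move=> Jv; apply/submxP; exists (v *m J^T *m A^T).
  rewrite /W mulmxA -[v *m J^T *m A^T *m A]mulmxA [v *m J^T *m _](_ : _ = v *m J^T).
    by rewrite -mulmxA JJ' mulmx1.
  apply/rowP => k; rewrite [LHS]mxE.
  have AAk l : (A^T *m A) l k = (free_idx S Z k && (l == k))%:R.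
    rewrite mxE; have [fk|nfk] := boolP (free_idx S Z k).
      rewrite (bigD1 (enum_rank_in fk k)) //= big1 => [|i ik].
        by rewrite !mxE enum_rankK_in// eqxx mulr1 addr0 eq_sym.
      rewrite !mxE [_ == k](_ : _ = false) ?mulr0//; apply: contraNF ik => /eqP ei.
      by apply/eqP/enum_val_inj; rewrite enum_rankK_in.
    rewrite big1 // => i _; rewrite !mxE [_ == k](_ : _ = false) ?mulr0//.
    by apply: contraNF nfk => /eqP <-; exact: (enum_valP _ : _ \in free_idx S Z).
  under eq_bigr do rewrite AAk.
  rewrite (bigD1 k) //= big1 => [|l /negPf ->]; last by rewrite andbF mulr0.
  rewrite addr0 eqxx andbT; have [|nfk] := boolP (free_idx S Z k); first by rewrite mulr1.
  by rewrite mulr0 -[RHS]/((v *m J^T) 0 k) -[v *m J^T]trmxK trmx_mul trmxK mxE Jv.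
apply/eqP; rewrite -{1}rW eqn_leq; apply/andP; split; apply: mxrankS; apply/rV_subP => v.
  move=> /sub_kermxP vJ; apply: supp; apply: differential_free => // g.
  rewrite If => -[h ->].
  under eq_bigr do rewrite raddf_sum peval_sum /= mulr_sumr.
  rewrite exchange_big big1 //= => i _.
  (* The generators vanish at [p], so the product rule leaves only their differentials. *)
  under eq_bigr => k _.
    rewrite mpoly.mderivM pevalD !pevalM [peval (f i) p]fX// mulr0 add0r mulrCA; over.
  by rewrite -mulr_sumr -jacE vJ mxE mulr0.
move=> /submxP[u vE]; apply/sub_kermxP; apply/rowP => i; rewrite jacE mxE.
apply: differential_dmset => // k nfk.
have -> : jac_mx S p p *m v^T = A^T *m u^T.
  by rewrite -/J -[J]trmxK -trmx_mul vE /W -!mulmxA JJ mulmx1 trmx_mul.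
rewrite mxE big1 // => j _; rewrite !mxE [_ == k](_ : _ = false) ?mul0r//.
by apply: contraNF nfk => /eqP <-; exact: (enum_valP _ : _ \in free_idx S Z).
Qed.

(** Only the ideal of [X] enters, so that the full-dimensional components are covered too. The
    closure is irreducible and hence its own unique component. *)
Lemma smooth_at_closure (X : set 'rV[R]_m) p :
  vanishing_ideal X = vanishing_ideal (dmset S Z) -> dmset S Z p -> smooth_at X p.
Proof.
move=> XI Xp.
have clE : zariski_closure X = zariski_closure (dmset S Z) by rewrite /zariski_closure XI.
have irr := irreducible_closure (dmset_neq0 R Sdiag Zdiag) (dmset_prime R Sdiag Zdiag SZ).
exists (zariski_closure (dmset S Z)).
  rewrite clE; split.
    by split; [exact/irreducible_component_self | exact: sub_zariski_closure].
  by move=> W [/irreducible_component_self ->].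
have [s [sI sE]] := hilbert_basis (vanishing_ideal_set (dmset S Z : set 'rV[R]_m)).
exists (size s), (fun i => s`_i); rewrite vanishing_zariski_closure -ideal_spanE; split => //.
rewrite (tangent_rank Xp); last by rewrite sE ideal_spanE.
rewrite -(dmset_dimension R Sdiag Zdiag SZ); apply: dimension_vanishing.
- by rewrite vanishing_zariski_closure.
- by exists p.
- by exists p; exact: sub_zariski_closure.
Qed.

End Smoothness.

(** * The double Markovian model *)

Section DoubleMarkovianModel.
Variables (R : realType) (n : nat) (G H : sgraph n).
Local Notation m := (sym_dim n).

Lemma adjC (K : sgraph n) i j : adj K i j = adj K j i.
Proof. by rewrite /adj finset.setUC. Qed.

Lemma adj_irrefl (K : sgraph n) i : adj K i i = false.
Proof.
apply/negP => h; have := forall_inP (edges_card2 K) _ h.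
by rewrite finset.setUid cards1.
Qed.

(* For arbitrary [G] and [H] the set [dmset concentration_idx covariance_idx] is the
   model of [G'] and [H], where [G'] is [G] with all non-edges of [H] added; then
   [G'] and [H] cover the complete graph and have the same common edges. *)
Definition concentration_idx : pred 'I_m :=
  fun k => adj H (pidx k).1 (pidx k).2 && ~~ adj G (pidx k).1 (pidx k).2.

Definition covariance_idx : pred 'I_m :=
  fun k => ((pidx k).1 != (pidx k).2) && ~~ adj H (pidx k).1 (pidx k).2.

Local Notation S := concentration_idx.
Local Notation Z := covariance_idx.

Lemma pidx_diag (i : 'I_n) : pidx (kidx i i) = (i, i).
Proof. by rewrite pidx_kidx leqnn. Qed.

Lemma concentration_diag i : ~~ S (kidx i i).
Proof. by rewrite /S pidx_diag adj_irrefl. Qed.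

Lemma covariance_diag i : ~~ Z (kidx i i).
Proof. by rewrite /Z pidx_diag eqxx. Qed.

Lemma covariance_concentration k : Z k -> ~~ S k.
Proof. by rewrite /Z /S => /andP[_ /negPf->]. Qed.

Lemma card_diag_idx : #|[set k : 'I_m | (pidx k).1 == (pidx k).2]%SET| = n.
Proof.
have inj : injective (fun i : 'I_n => kidx i i).
  by move=> i j /(congr1 (@pidx n)); rewrite !pidx_diag => -[].
rewrite -[RHS]card_ord -(fintype.card_image inj).
apply: eq_card => k; rewrite inE; apply/eqP/fintype.imageP => [kk|[i _ ->]].
  by exists (pidx k).1 => //; rewrite {2}kk kidxK.
by rewrite pidx_diag.
Qed.

Lemma card_edge_idx : #|[set k : 'I_m | adj G (pidx k).1 (pidx k).2
    && adj H (pidx k).1 (pidx k).2]%SET| = #|edges G :&: edges H|.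
Proof.
rewrite -(card_in_imset (f := fun k : 'I_m => [set (pidx k).1; (pidx k).2]%SET)).
  apply: eq_card => e; rewrite inE; apply/imsetP/andP => [[k + ->]|[eG eH]].
    by rewrite inE => /andP.
  have /cards2P[a [b [_ eab]]] : #|e| == 2%N by exact: (forall_inP (edges_card2 G)).
  have ek : e = [set (pidx (kidx a b)).1; (pidx (kidx a b)).2]%SET.
    by rewrite pidx_kidx; case: leqP => _ //=; rewrite finset.setUC.
  by exists (kidx a b) => //; rewrite inE /adj -ek eG.
move=> k l _ _ kl; have : (pidx l).1 \in [set (pidx k).1; (pidx k).2]%SET.
  by rewrite kl !inE eqxx.
have : (pidx l).2 \in [set (pidx k).1; (pidx k).2]%SET by rewrite kl !inE eqxx orbT.
have : (pidx k).1 \in [set (pidx l).1; (pidx l).2]%SET by rewrite -kl !inE eqxx.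
have : (pidx k).2 \in [set (pidx l).1; (pidx l).2]%SET by rewrite -kl !inE eqxx orbT.
rewrite !inE -[k in k = l]kidxK -[l in _ = l]kidxK.
move=> /orP[]/eqP-> /orP[]/eqP-> /orP[]/eqP e1 /orP[]/eqP e2 //;
  by rewrite ?e1 ?e2 // kidxC.
Qed.

Lemma card_free_idx : #|free_idx S Z| = (#|edges G :&: edges H| + n)%N.
Proof.
transitivity (#|[set k : 'I_m | adj G (pidx k).1 (pidx k).2 && adj H (pidx k).1 (pidx k).2]%SET|
  + #|[set k : 'I_m | (pidx k).1 == (pidx k).2]%SET|)%N; last first.
  by congr (_ + _)%N; [exact: card_edge_idx | exact: card_diag_idx].
rewrite -cardsUI addnC [(_ :&: _)%SET](_ : _ = finset.set0); last first.
  apply/finset.setP => k; rewrite !inE; apply/negP => /andP[/andP[Gk _] /eqP kk].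
  by rewrite kk adj_irrefl in Gk.
rewrite cards0; apply: eq_card => k; rewrite !inE unfold_in /free_idx /S /Z.
have [kk|] := eqVneq (pidx k).1 (pidx k).2; first by rewrite kk !adj_irrefl.
by move=> _; rewrite orbF !negb_and !negbK; case: (adj G _ _); case: (adj H _ _).
Qed.

Lemma adj_invmx (B : 'M[R]_n) i j : posdef B -> \adj B i j = \det B * invmx B i j.
Proof.
move=> Bp; have Bu := posdef_unit Bp; rewrite /invmx Bu [X in _ * X]mxE mulrA divff ?mul1r//.
by rewrite -unitfE -unitmxE.
Qed.

Lemma dm_model_sub : dm_model R G H `<=` dmset S Z.
Proof.
move=> _ [B [Bp KG BH] <-]; have Bs := symmxK Bp.1; split.
- by rewrite Bs.
- move=> k /andP[Hk Gk]; rewrite Bs adj_invmx// KG ?mulr0//.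
  by apply: contraTneq Hk => ->; rewrite adj_irrefl.
- move=> k /andP[kk Hk]; rewrite -symmx_pidx Bs; exact: BH.
Qed.

(** A non-edge of [G] is an edge of [H] and so is indexed by [S]; hence [dmset] imposes all
    constraints of the model. *)
Lemma dm_model_complete : graph_union G H = complete_graph n ->
  dm_model R G H = dmset S Z.
Proof.
move=> GH; apply/seteqP; split; first exact: dm_model_sub.
have total i j : i != j -> ~~ adj G i j -> adj H i j.
  move=> ij /negPf Gij; have : [set i; j]%SET \in edges (graph_union G H).
    by rewrite GH inE cards2 ij.
  by rewrite inE -[X in X || _]/(adj G i j) Gij.
move=> x [px ax zx]; exists (symmx x); last exact: sym_coordK.
(* Symmetric conditions need checking only at the sorted pair. *)
have wlog_idx (P : 'I_n -> 'I_n -> Prop) i j : (forall i j, P i j -> P j i) ->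
    P (pidx (kidx i j)).1 (pidx (kidx i j)).2 -> P i j.
  by move=> Psym; rewrite pidx_kidx; case: leqP => _ //=; exact: Psym.
split => // [i j ij Gij|k l kl Hkl].
  have := total _ _ ij Gij => Hij.
  suff : \adj (symmx x) i j = 0.
    rewrite adj_invmx// => /eqP; rewrite mulf_eq0 (negPf (posdef_det_neq0 px)).
    by move/eqP.
  apply: (wlog_idx (fun i j => \adj (symmx x) i j = 0)).
    by move=> a b h; rewrite -(adj_tr (symmx_tr x)) [LHS]mxE.
  apply: ax; apply: (wlog_idx (fun a b => adj H a b && ~~ adj G a b)
    (pidx (kidx i j)).1 (pidx (kidx i j)).2).
    by move=> a b; rewrite (adjC H) (adjC G).
  by rewrite kidxK pidx_kidx; case: leqP => _ /=; rewrite ?Hij// adjC Hij adjC.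
rewrite mxE; apply: zx; rewrite /Z pidx_kidx; case: leqP => _ /=; first by rewrite kl.
by rewrite eq_sym kl adjC.
Qed.

End DoubleMarkovianModel.

Theorem theorem2 (R : realType) (n : nat) (G H : sgraph n) :
  let d : \bar R := (#|edges G :&: edges H| + n)%N%:R%:E in
  [/\ (dimension (dm_model R G H) <= d)%E,
      graph_union G H = complete_graph n ->
        smooth (dm_model R G H) /\ dimension (dm_model R G H) = d &
      dimension (dm_model R G H) = d ->
        forall C : set 'rV[R]_(sym_dim n),
          is_connected_component (dm_model R G H) C -> dimension C = d ->
          smooth C /\ irreducible (zariski_closure C)].
Proof.
move=> d; rewrite /d -card_free_idx.
have Sd := @concentration_diag n G H; have Zd := @covariance_diag n H.
have SZ := @covariance_concentration n G H.
pose X : set 'rV[R]_(sym_dim n) := dmset (concentration_idx G H) (covariance_idx H).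
have MX : dm_model R G H `<=` X := @dm_model_sub R n G H.
split.
- apply: dimension_le => k /(prime_chainS (vanishing_idealS MX)).
  exact: dmset_chain_le.
- move=> /(@dm_model_complete R) ->; split; last exact: dmset_dimension.
  by move=> p Xp; apply: smooth_at_closure Xp.
- move=> _ C [p Mp CE] /dimension_chain[C0 [k dk Ck]].
  have CX : C `<=` X.
    by apply: subset_trans MX; rewrite CE; exact: connected_component_sub.
  have IX : vanishing_ideal C = vanishing_ideal X.
    (* Otherwise the prime ideal of [X] prolongs a chain of length [k >= d] beyond the bound [d]. *)
    apply: contrapT => IXC.
    have /(dmset_chain_le Sd SZ) : prime_chain (vanishing_ideal X) k.+1.
      apply: prime_chain_extend Ck; first exact: dmset_prime.
        exact: vanishing_idealS.
      by move=> e; apply: IXC.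
    by rewrite ltnNge dk.
  split; first by move=> q /CX; exact: smooth_at_closure.
  rewrite /zariski_closure IX; apply: irreducible_closure.
    exact: dmset_neq0.
  exact: dmset_prime.
Qed.
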